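(* Let $\Gamma=(V,E)$ be a graph, let $Z\subseteq\mathbb{R}^E$ be its real cycle space, and let $P := Z\cap[-1,1]^E$. For integers $k>0$ let $\phi_\Gamma(k)$ be the number of nowhere-zero $k$-flows on $\Gamma$. (a) $\phi_\Gamma(k)$ is a polynomial function of $k$ for $k=1,2,3,\ldots$. It has leading term $(\operatorname{vol} P)\,k^{\xi(\Gamma)}$ if $\Gamma$ has no isthmi; otherwise it is identically zero. (b) Furthermore, $(-1)^{\xi(\Gamma)}\phi_\Gamma(-k)$ for $k\ge 0$ (the polynomial of (a) evaluated at $-k$) equals the number of $(k+1)$-flows on $\Gamma$ counted with multiplicity equal to the number of totally cyclic orientations of $\Gamma$ that are compatible with the flow. (c) In particular, the constant term $\phi_\Gamma(0)$ equals the number of totally cyclic orientations of $\Gamma$, which equals $(-1)^{\xi(\Gamma)}\bar\phi_\Gamma(-1)$. (d) Finally, the total number of $k$-flows on $\Gamma$ for $k>0$, nowhere-zero or not, is a polynomial $\phi^0_\Gamma(k)$ satisfying $\phi^0_\Gamma(k)=(-1)^{\xi(\Gamma)}\phi^0_\Gamma(1-k)$, whose leading term is the same as that of $\phi_\Gamma(k)$ and whose constant term is $(-1)^{\xi(\Gamma)}$.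
   Context: Graphs are finite; loops and multiple edges are allowed. Fix an arbitrary orientation of $\Gamma$, with $h(e),t(e)$ the head and tail of edge $e$. For an abelian group $A$, an $A$-flow is a map $x:E\to A$ with $\sum_{h(e)=v}x(e)=\sum_{t(e)=v}x(e)$ for every node $v\in V$. Reversing the orientation of $e$ replaces $x(e)$ by $-x(e)$, so the notion does not depend on the chosen orientation. A flow is nowhere-zero if it never takes the value $0$. A $k$-flow is a $\mathbb{Z}$-flow with $|x(e)|<k$ for all $e\in E$. The real cycle space $Z$ is the space of all $\mathbb{R}$-flows. $\xi(\Gamma)=|E|-|V|+c(\Gamma)$ is the cyclomatic number, where $c(\Gamma)$ is the number of connected components. An isthmus is an edge whose deletion increases the number of connected components. A circle is a connected 2-regular subgraph (a loop is a circle). In an oriented graph, a cycle is a circle whose edges are oriented in a consistent direction; an orientation is totally cyclic if every edge lies in a cycle. Each edge, including each loop, has two orientations. A totally cyclic orientation $\tau$ and a flow $x$ are compatible if $x\ge0$ on every edge when $x$ is expressed in terms of $\tau$ (i.e. after replacing $x(e)$ by $-x(e)$ for each edge on which $\tau$ differs from the fixed orientation). $\operatorname{vol}P$ is the volume of $P$ normalized with respect to $Z\cap\mathbb{Z}^E$: a fundamental domain of the lattice $Z\cap\mathbb{Z}^E$ in $Z$ has volume $1$. $\bar\phi_\Gamma$ is the (strict) modular flow polynomial: the polynomial (which exists by a theorem of Tutte) such that for every finite abelian group $A$ the number of nowhere-zero $A$-flows on $\Gamma$ is $\bar\phi_\Gamma(|A|)$.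
   Formalization: In (c) a missing sign is restored: (−1)^ξ φ_Γ(0) is the number of totally cyclic orientations (one loop has φ_Γ(0) = −2 but 2 orientations). In (d), φ⁰_Γ always has leading term (vol P)k^ξ; it is said to equal that of φ_Γ only if Γ has no isthmi, as otherwise φ_Γ = 0. *)

(* Defs.v *)
From mathcomp Require Import all_boot all_order all_algebra.

Set Implicit Arguments.
Unset Strict Implicit.
Unset Printing Implicit Defensive.

Import Order.TTheory GRing.Theory Num.Theory.
Local Open Scope ring_scope.

(* A finite graph, loops and multiple edges allowed, together with the fixed
   reference orientation (ehead, etail). *)
Record graph := Graph {
  node : finType;
  edge : finType;
  ehead : edge -> node;
  etail : edge -> node }.

Section Combinatorics.
Variable G : graph.
Implicit Types (C : {set edge G}) (u v : node G) (e : edge G).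

Definition adj C : rel (node G) := fun u v =>
  [exists e in C, ((ehead e == u) && (etail e == v))
               || ((ehead e == v) && (etail e == u))].

Definition ncomponents C : nat := n_comp (adj C) (node G).

(* The truncated subtraction is exact: #|V| <= #|E| + c for every graph. *)
Definition cyclomatic : nat :=
  (#|edge G| + ncomponents [set: edge G] - #|node G|)%N.

Definition isthmus e : bool :=
  (ncomponents [set: edge G] < ncomponents [set~ e])%N.

(* A loop contributes 2 to the degree of its node. *)
Definition degree C v : nat :=
  (\sum_(e in C) ((ehead e == v) + (etail e == v)))%N.

(* A 2-regular subgraph is determined by its edge set C: its nodes are the
   nodes of positive degree in C. *)
Definition circle C : bool :=
  [&& C != set0,
      [forall v, (0 < degree C v)%N ==> (degree C v == 2)] &
      [forall u, forall v, (0 < degree C u)%N ==> (0 < degree C v)%N ==>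
         connect (adj C) u v]].

(* t e = true means that e keeps its reference orientation. *)
Definition orientation := {ffun edge G -> bool}.

Implicit Type t : orientation.

Definition ohead t e : node G := if t e then ehead e else etail e.
Definition otail t e : node G := if t e then etail e else ehead e.

(* On a circle, where all degrees are 2, the directions are consistent iff
   every node is entered as many times as it is left. *)
Definition oriented_cycle t C : bool :=
  circle C &&
  [forall v, (\sum_(e in C) (ohead t e == v) ==
              \sum_(e in C) (otail t e == v))%N].

Definition totally_cyclic t : bool :=
  [forall e, exists C : {set edge G}, (e \in C) && oriented_cycle t C].

Definition is_flow (A : zmodType) (x : {ffun edge G -> A}) : bool :=
  [forall v, \sum_(e | ehead e == v) x e == \sum_(e | etail e == v) x e].

Definition nowhere_zero (A : zmodType) (x : {ffun edge G -> A}) : bool :=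
  [forall e, x e != 0].

Definition compatible t (x : {ffun edge G -> int}) : bool :=
  [forall e, 0 <= (if t e then x e else - x e)].

Definition num_totally_cyclic : nat :=
  #|[pred t : orientation | totally_cyclic t]|.

Definition num_compatible (x : {ffun edge G -> int}) : nat :=
  #|[pred t : orientation | totally_cyclic t && compatible t x]|.

Definition num_nz_flows (A : finZmodType) : nat :=
  #|[pred x : {ffun edge G -> A} | is_flow x && nowhere_zero x]|.

End Combinatorics.

From mathcomp Require Import finmap all_classical all_reals all_analysis.
Local Open Scope classical_set_scope.

Definition kflows (G : graph) (k : nat) : set {ffun edge G -> int} :=
  [set x | is_flow x /\ forall e, `|x e| < k%:Z].
Arguments kflows : clear implicits.

Definition nz_kflows (G : graph) (k : nat) : set {ffun edge G -> int} :=
  [set x | kflows G k x /\ nowhere_zero x].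
Arguments nz_kflows : clear implicits.

(* The number of elements of a finite set (0 on infinite sets). *)
Definition ncard (T : choiceType) (A : set T) : nat := #|` fset_set A|%fset.

(* Any two polynomials in this set agree at all positive integers, so at most
   one exists; existence is Tutte's theorem. *)
Definition modular_flow_poly (R : realType) (G : graph) : {poly R} :=
  xget 0 [set q : {poly R} | forall A : finZmodType,
            q.[#|A|%:R] = (num_nz_flows G A)%:R].

(* Lebesgue measure on R^n, as an iterated product of the one on R. *)
Fixpoint lebesgue_vol (R : realType) (n : nat) : set (n.-tuple R) -> \bar R :=
  match n with
  | 0%N => \d_([tuple] : 0.-tuple R)
  | m.+1 => pushforward (@lebesgue_measure R \x @lebesgue_vol R m)%E
              (fun p : R * m.-tuple R => [tuple of p.1 :: p.2])
  end.

Section LatticeVolume.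
Variables (R : realType) (T : finType).
Implicit Types L A : set {ffun T -> R}.

Definition lincomb n (b : n.-tuple {ffun T -> R}) (y : 'I_n -> R) :
    {ffun T -> R} :=
  [ffun e => \sum_(i < n) y i * tnth b i e].

Definition lattice_basis L n (b : n.-tuple {ffun T -> R}) : Prop :=
  (forall y : 'I_n -> R, lincomb b y = 0 -> forall i, y i = 0) /\
  L = [set lincomb b (fun i => (z i)%:~R) | z in [set: 'I_n -> int]].

Definition a_lattice_basis L : {n : nat & n.-tuple {ffun T -> R}} :=
  xget (existT _ 0%N [tuple])
    [set nb : {n : nat & n.-tuple {ffun T -> R}} |
      lattice_basis L (projT2 nb)].

(* The volume, in the real span of the lattice L, normalized so that a
   fundamental domain of L has volume 1: in the coordinates given by a basis
   of L, a fundamental domain is the unit cube.  The value does not depend on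
   the basis, as a change of basis has determinant 1 or -1. *)
Definition lattice_vol L A : \bar R :=
  let: existT n b := a_lattice_basis L in
  lebesgue_vol [set y : n.-tuple R | A (lincomb b (tnth y))].

End LatticeVolume.

Definition cycle_space (R : realType) (G : graph) : set {ffun edge G -> R} :=
  [set x | is_flow x].
Arguments cycle_space : clear implicits.

Definition flow_lattice (R : realType) (G : graph) : set {ffun edge G -> R} :=
  cycle_space R G `&` [set x | forall e, x e \is a Num.int].
Arguments flow_lattice : clear implicits.

Definition flow_polytope (R : realType) (G : graph) : set {ffun edge G -> R} :=
  cycle_space R G `&` [set x | forall e, -1 <= x e <= 1].
Arguments flow_polytope : clear implicits.

Definition flow_vol (R : realType) (G : graph) : \bar R :=
  lattice_vol (flow_lattice R G) (flow_polytope R G).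

Definition has_leading_term (R : realType) (p : {poly R}) (c : \bar R)
    (n : nat) : Prop :=
  (lead_coef p)%:E = c /\ size p = n.+1.

(* Main.v *)
From HB Require Import structures.
Require Import Defs.
From mathcomp Require Import all_boot all_order all_algebra.
From mathcomp Require Import finmap all_classical all_reals all_analysis.
From mathcomp Require Import measurable_realfun.
From mathcomp Require Import ring lra zify.

Set Implicit Arguments.
Unset Strict Implicit.
Unset Printing Implicit Defensive.

Import Order.TTheory GRing.Theory Num.Theory.
Local Open Scope classical_set_scope.
Local Open Scope ring_scope.

(** The flows bounded by [k] are the integer points of the [k]-th dilation of a
polytope cut out of a lattice by walls, and everything follows from Ehrhart
reciprocity for such polytopes, in a form adapted to total unimodularity.

Reciprocity.  Let [d] be a lattice direction on which every wall functional
takes a value in [{-1, 0, 1}].  A polynomial weight [p] has a polynomial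
antiderivative [F] along [d], [F u - F (u - d) = p u], so the sum of [p] over the
polytope telescopes to sums of shifts of [F] over the faces transversal to [d]
([discrete_divergence]).  Those faces are polytopes of the same kind in a lattice
of smaller rank, so induction gives a polynomial in [k].  To count each boundary
point once, ties between walls are settled by one generic interior point [q],
projected from face to face: a wall is included when [q] is on its nonnegative
side.  At the start [q] includes all walls and [- q] excludes all of them.  The
recursions for [q] and [- q] are exchanged by [u |-> - u] up to one sign in each
dimension, which is reciprocity ([half_open_reciprocity], [box_reciprocity]).

Flows.  A nonzero flow contains a cycle, so the lattice of flows supported by a
set of edges contains a vector with entries in [{-1, 0, 1}], and deleting an edge
of the cycle gives a lattice of the same kind ([regular_flows]).  Hence reciprocity
applies to two kinds of boxes.  For a totally cyclic orientation, the box of flows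
between [0] and [k] in the directions of the orientation has an interior point;
each nowhere-zero flow is interior to the box of exactly one orientation, while
closed boxes count compatible orientations ([nowhere_zero_polynomial]).  The box
[- k <= x <= k] has the same integer points as [- (k + 1) < x < k + 1], which turns
reciprocity into the functional equation for the number of all flows
([kflows_on_polynomial]).  That equation gives the constant term [(-1) ^ rank] for
each spanning subgraph; inclusion-exclusion over spanning subgraphs then
compares the constant term for nowhere-zero flows with the modular flow polynomial
at [-1], because the latter is the same alternating sum of [#|A| ^ rank]
([constant_term_modular]).

Leading terms.  Rounding to the grid of mesh [1 / k] in the coordinates of any
lattice basis places [k ^ rank] times the volume of the polytope between the numbers
of integer points of the dilations by [k - B] and [k + B], with [B] fixed
([basis_leading_term]).
Flows with a zero entry have lower order unless there is an isthmus
([nowhere_zero_same_lead]), and an isthmus excludes totally cyclic orientations. *)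

(** * Polynomial functions and discrete antiderivatives *)

Lemma subrACA (V : zmodType) (x y z w : V) : (x - y) - (z - w) = (x - z) - (y - w).
Proof. by rewrite !opprB addrACA [RHS]addrACA; congr (_ + _); exact: addrC. Qed.

Section PolynomialFunctions.
Variables (R : numFieldType) (U : zmodType).

(** Polynomial functions are generated from additive ones rather than written in
coordinates, so that they restrict to sublattices without a choice of basis. *)
Inductive polyfun : (U -> R) -> Prop :=
| polyfun_cst c : polyfun (fun=> c)
| polyfun_additive (l : {additive U -> int}) : polyfun (fun u => (l u)%:~R)
| polyfunD p q : polyfun p -> polyfun q -> polyfun (fun u => p u + q u)
| polyfunM p q : polyfun p -> polyfun q -> polyfun (fun u => p u * q u).

Lemma polyfun_shift p v : polyfun p -> polyfun (fun u => p (u + v)).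
Proof.
elim=> [c|l|{}p q _ hp _ hq|{}p q _ hp _ hq].
- exact: polyfun_cst.
- under eq_fun do rewrite raddfD rmorphD.
  exact: polyfunD (polyfun_additive _) (polyfun_cst _).
- exact: polyfunD hp hq.
- exact: polyfunM hp hq.
Qed.

Lemma polyfunZ c p : polyfun p -> polyfun (fun u => c * p u).
Proof. exact: polyfunM (polyfun_cst c). Qed.

Lemma polyfun_line p v :
  polyfun p -> exists w : {poly R}, forall k : int, p (v *~ k) = w.[k%:~R].
Proof.
elim=> [c|l|{}p q _ [w hw] _ [z hz]|{}p q _ [w hw] _ [z hz]].
- by exists c%:P => k; rewrite hornerC.
- exists ((l v)%:~R *: 'X) => k; rewrite hornerZ hornerX raddfMz.
  by rewrite mulrzz intrM.
- by exists (w + z) => k; rewrite hornerD hw hz.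
- by exists (w * z) => k; rewrite hornerM hw hz.
Qed.

Section Antiderivative.
Variables (d : U) (l : {additive U -> int}).
Hypothesis ld : l d = 1.

Let proj (u : U) : U := u - d *~ l u.

Fact proj_is_additive : zmod_morphism proj.
Proof.
by move=> u v; rewrite /proj raddfB mulrzBr subrACA.
Qed.
HB.instance Definition _ :=
  GRing.isZmodMorphism.Build U U proj proj_is_additive.

Let proj_shift u : proj (u - d) = proj u.
Proof.
by rewrite raddfB /= {2}/proj ld mulr1z subrr subr0.
Qed.

Definition rising (i : nat) (t : R) : R := \prod_(j < i) (t + j%:R).

(** Rising factorials rather than powers: the difference of the next one along
[d] is again a multiple of the same rising factorial, so no summation formula
for powers is needed. *)
Inductive rising_span : (U -> R) -> Prop :=
| rising_term a i : polyfun a -> (forall u, a (u - d) = a u) ->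
    rising_span (fun u => a u * rising i (l u)%:~R)
| rising_add f g : rising_span f -> rising_span g ->
    rising_span (fun u => f u + g u).

Let rising_spanM_invariant a f : polyfun a -> (forall u, a (u - d) = a u) ->
  rising_span f -> rising_span (fun u => a u * f u).
Proof.
move=> pa inva; elim=> [b i pb invb|{}f g _ hf _ hg].
  under eq_fun do rewrite mulrA.
  by apply: rising_term => [|u]; [exact: polyfunM|rewrite inva invb].
by under eq_fun do rewrite mulrDr; exact: rising_add.
Qed.

Let rising_spanM_coord f : rising_span f -> rising_span (fun u => (l u)%:~R * f u).
Proof.
elim=> [b i pb invb|{}f g _ hf _ hg]; last first.
  by under eq_fun do rewrite mulrDr; exact: rising_add.
rewrite (_ : (fun u => _) = (fun u => b u * rising i.+1 (l u)%:~R
    + (- i%:R * b u) * rising i (l u)%:~R)); last first.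
  by apply/funext => u; rewrite /rising big_ord_recr /=; ring.
apply: rising_add; first exact: rising_term.
by apply: rising_term => [|u]; [exact: polyfunZ|rewrite invb].
Qed.

Lemma polyfun_rising_span p f :
  polyfun p -> rising_span f -> rising_span (fun u => p u * f u).
Proof.
move=> hp; elim: hp f => [c|m|{}p q _ hp _ hq|{}p q _ hp _ hq] f hf.
- by apply: rising_spanM_invariant => //; exact: polyfun_cst.
- rewrite (_ : (fun u => _) = (fun u => (m (proj u))%:~R * f u
      + (m d)%:~R * ((l u)%:~R * f u))); last first.
    apply/funext => u; rewrite mulrA -mulrDl -intrM -rmorphD; congr (_%:~R * _).
    by rewrite /proj raddfB raddfMz mulrzz; ring.
  apply: rising_add.
    apply: rising_spanM_invariant => //; first exact: (polyfun_additive (m \o proj)).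
    by move=> u; rewrite proj_shift.
  apply: rising_spanM_invariant => //; first exact: polyfun_cst.
  exact: rising_spanM_coord.
- by under eq_fun do rewrite mulrDl; apply: rising_add; [exact: hp|exact: hq].
- by under eq_fun do rewrite -mulrA; exact/hp/hq.
Qed.

Lemma rising_span_antiderivative f : rising_span f ->
  exists2 F, polyfun F & forall u, F u - F (u - d) = f u.
Proof.
elim=> [a i pa inva|{}f g _ [F pF hF] _ [H pH hH]]; last first.
  exists (fun u => F u + H u); first exact: polyfunD.
  by move=> u; rewrite -hF -hH; ring.
exists (fun u => (i.+1%:R^-1 * a u) * rising i.+1 (l u)%:~R) => [|u].
  apply: polyfunM; first exact: polyfunZ.
  rewrite /rising; elim: i.+1 => [|n ih].
    by under eq_fun do rewrite big_ord0; exact: polyfun_cst.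
  under eq_fun do rewrite big_ord_recr /=.
  apply: polyfunM ih (polyfunD (polyfun_additive _) (polyfun_cst _)).
rewrite inva raddfB ld /rising big_ord_recr big_ord_recl /=.
under [X in _ - _ * (_ * X)]eq_bigr do rewrite /bump /= natrD rmorphB /= addrA subrK.
have i0 : i.+1%:R != 0 :> R by rewrite pnatr_eq0.
rewrite rmorphB /= addr0; set P := \prod_(_ < _) _.
by move: i0; rewrite -natr1 => i0; field.
Qed.

(** Writing [u] as a multiple of [d] plus a [d]-invariant part turns any polynomial
function into a combination of rising factorials with invariant coefficients. *)
Lemma polyfun_antiderivative p : polyfun p ->
  exists2 F, polyfun F & forall u, F u - F (u - d) = p u.
Proof.
move=> hp; apply: rising_span_antiderivative.
rewrite (_ : p = fun u => p u * (1 * rising 0 (l u)%:~R)).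
  apply: polyfun_rising_span => //.
  by apply: (@rising_term (fun=> 1)) => //; exact: polyfun_cst.
by apply/funext => u; rewrite /rising big_ord0 !mulr1.
Qed.

End Antiderivative.
End PolynomialFunctions.

(** * Unimodular slicings of a lattice and generic points *)

Section UnimodularSlicing.
Variables (U : zmodType) (J : finType).
Variables (kappa : {additive U -> int}) (g : J -> {additive U -> int}).
Implicit Types (M : set U) (j : J) (u v d q : U).

Definition subgroup M := M 0 /\ forall u v, M u -> M v -> M (u - v).

Lemma subgroupN M u : subgroup M -> M u -> M (- u).
Proof. by case=> M0 MB Mu; rewrite -sub0r; exact: MB. Qed.

Lemma subgroupD M u v : subgroup M -> M u -> M v -> M (u + v).
Proof.
by move=> sM Mu Mv; rewrite -[v]opprK; apply: sM.2 => //; exact: subgroupN.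
Qed.

Lemma subgroupMz M u (z : int) : subgroup M -> M u -> M (u *~ z).
Proof.
move=> sM Mu; have MX n : M (u *+ n).
  by elim: n => [|n ih]; rewrite ?mulr0n ?mulrS; [exact: sM.1|exact: subgroupD].
by case: z => n; [exact: MX|rewrite NegzE mulrNz; apply: subgroupN => //; exact: MX].
Qed.

Definition slice M j : set U := M `&` [set u | g j u = 0].

(** Projection along [d] to the wall [j]; it is integral because [g j d] is its own
inverse. *)
Definition sproj d j u : U := u - d *~ (g j d * g j u).

Lemma sprojE d j u : sproj d j u = u - d *~ (g j d * g j u).
Proof. by []. Qed.

Fact sproj_is_additive d j : zmod_morphism (sproj d j).
Proof.
by move=> u v; rewrite /sproj raddfB mulrBr mulrzBr subrACA.
Qed.
HB.instance Definition _ d j :=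
  GRing.isZmodMorphism.Build U U (sproj d j) (sproj_is_additive d j).

Definition unit_or_zero (z : int) := z \in [:: -1; 0; 1].

Lemma unit_sqr (z : int) : unit_or_zero z -> z != 0 -> z * z = 1.
Proof. by rewrite /unit_or_zero !inE => /or3P[] /eqP->. Qed.

Lemma sproj_slice M d j u : subgroup M -> M d -> M u ->
  unit_or_zero (g j d) -> g j d != 0 -> slice M j (sproj d j u).
Proof.
move=> sM Md Mu uz nz; split.
  by apply: sM.2 => //; exact: subgroupMz.
by rewrite /= raddfB raddfMz mulrzz mulrA unit_sqr // mul1r subrr.
Qed.

Lemma sproj_id M d j u : slice M j u -> sproj d j u = u.
Proof. by move=> [_ /= gu]; rewrite /sproj gu mulr0 mulr0z subr0. Qed.

Lemma sproj_d d j : unit_or_zero (g j d) -> g j d != 0 -> sproj d j d = 0.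
Proof. by move=> uz nz; rewrite /sproj unit_sqr // mulr1z subrr. Qed.

Lemma kappa_sproj d j u : kappa d = 0 -> kappa (sproj d j u) = kappa u.
Proof. by move=> kd; rewrite raddfB raddfMz kd mul0rz subr0. Qed.

(** The abstract form of total unimodularity used below: some lattice direction
[d] of height [kappa d = 0] meets each wall [g j = 0] transversally with index
one, or is parallel to it, and the faces so obtained are again of this kind.
The rank [n] excludes the height coordinate. *)
Inductive unimodular : set U -> nat -> Prop :=
| unimodular0 M m of M m & kappa m = 1
    & (forall u, M u -> u = m *~ kappa u) & subgroup M : unimodular M 0
| unimodularS M n d of subgroup M & M d & kappa d = 0
    & (forall j, unit_or_zero (g j d))
    & (exists j, g j d = -1) & (exists j, g j d = 1)
    & (forall j, g j d != 0 -> unimodular (slice M j) n) : unimodular M n.+1.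

Definition generic_in M q := forall j, g j q = 0 -> forall u, M u -> g j u = 0.

(** A unimodular slicing together with a point that stays generic after being
projected to every face reached by the slicing; this one point settles all ties
between constraints consistently. *)
Inductive generic_slicing : set U -> U -> nat -> Prop :=
| generic_slicing0 M q m of M m & kappa m = 1
    & (forall u, M u -> u = m *~ kappa u) & subgroup M & M q & 0 < kappa q :
    generic_slicing M q 0
| generic_slicingS M q n d of subgroup M & M d & kappa d = 0
    & (forall j, unit_or_zero (g j d))
    & (exists j, g j d = -1) & (exists j, g j d = 1)
    & M q & generic_in M q
    & (forall j, g j d != 0 -> generic_slicing (slice M j) (sproj d j q) n) :
    generic_slicing M q n.+1.

Lemma generic_slicing_generic M q n : generic_slicing M q n -> generic_in M q.
Proof.
case=> // {M q n} M q m Mm km1 Mk _ Mq kq j gq u Mu.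
move: gq; rewrite (Mk _ Mq) (Mk _ Mu) !raddfMz !mulrzz => /eqP.
by rewrite mulf_eq0 (gt_eqF kq) orbF => /eqP->; rewrite mul0r.
Qed.

(** Defining polynomials of finite hyperplane arrangements in [M]. *)
Inductive arrangement M : (U -> int) -> Prop :=
| arrangement1 : arrangement M (fun=> 1)
| arrangementM (h : {additive U -> int}) f u of M u & h u != 0
    & arrangement M f : arrangement M (fun q => h q * f q).

Lemma arrangement_mul M f f' : arrangement M f -> arrangement M f' ->
  arrangement M (fun q => f q * f' q).
Proof.
move=> hf hf'; elim: hf => [|h {}f u Mu hu _ ih].
  by under eq_fun do rewrite mul1r.
by under eq_fun do rewrite -mulrA; apply: (arrangementM Mu).
Qed.

Lemma arrangement_prod M (I : Type) (r : seq I) (P : pred I) (f : I -> U -> int) :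
  (forall i, P i -> arrangement M (f i)) ->
  arrangement M (fun q => \prod_(i <- r | P i) f i q).
Proof.
move=> hf; elim: r => [|i r ih].
  rewrite (_ : (fun q => _) = fun=> 1); first exact: arrangement1.
  by apply/funext => q; rewrite big_nil.
have [Pi|Pi] := boolP (P i); last first.
  rewrite (_ : (fun q => _) = fun q => \prod_(i <- r | P i) f i q) //.
  by apply/funext => q; rewrite big_cons (negbTE Pi).
rewrite (_ : (fun q => _) = fun q => f i q * \prod_(i <- r | P i) f i q).
  by apply: arrangement_mul => //; exact: hf.
by apply/funext => q; rewrite big_cons Pi.
Qed.

Lemma arrangement_sproj M d j f : subgroup M -> M d ->
  unit_or_zero (g j d) -> g j d != 0 ->
  arrangement (slice M j) f -> arrangement M (fun q => f (sproj d j q)).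
Proof.
move=> sM Md uz nz; elim=> [|h {}f u Mu hu _ ih]; first exact: arrangement1.
apply: (@arrangementM M (h \o sproj d j) _ u) => //; first exact: Mu.1.
by rewrite /= (sproj_id _ Mu).
Qed.

Lemma affine_int_large (a b : int) : a != 0 \/ b != 0 ->
  exists T : nat, forall t : nat, (T <= t)%N -> a * t%:Z + b != 0.
Proof.
move=> ab; exists (`|b|.+1)%N => t ht; apply/eqP => h.
have hb : b = - (a * t%:Z) by apply/eqP; rewrite -addr_eq0 addrC h.
have a0 : a != 0 by case: ab => // b0; apply: contra_neq b0 => a0; rewrite hb a0; lia.
have : (`|b| = `|a| * t)%N by rewrite hb abszN abszM.
have : (0 < `|a|)%N by rewrite absz_gt0.
nia.
Qed.

Lemma arrangement_open M f v : arrangement M f -> f v != 0 ->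
  forall w, exists T : nat, forall t : nat, (T <= t)%N -> f (v *+ t + w) != 0.
Proof.
elim=> [_ w|h {}f u Mu hu _ ih /= + w]; first by exists 0%N.
rewrite mulf_eq0 negb_or => /andP[hv /ih{ih} /(_ w) [T hT]].
have [T' hT'] := affine_int_large (or_introl hv : _ \/ h w != 0).
exists (maxn T T') => t; rewrite geq_max => /andP[/hT hf /hT' hh].
by rewrite mulf_neq0 // raddfD raddfMn -mulr_natr natz.
Qed.

(** A good point for the other hyperplanes is kept good by scaling it up before
correcting it for one more hyperplane. *)
Lemma arrangement_avoid M f : subgroup M -> arrangement M f ->
  exists2 v, M v & f v != 0.
Proof.
move=> sM; elim=> [|h {}f u Mu hu hf [v Mv fv]]; first by exists 0 => //; exact: sM.1.
have [T hT] := arrangement_open hf fv u.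
have [T' hT'] : exists T' : nat, forall t : nat, (T' <= t)%N -> h v * t%:Z + h u != 0.
  by apply: affine_int_large; right.
exists (v *+ maxn T T' + u).
  by apply: subgroupD => //; rewrite pmulrn; exact: subgroupMz.
rewrite mulf_neq0 ?hT ?leq_maxl // raddfD raddfMn -mulr_natr natz.
by rewrite hT' ?leq_maxr.
Qed.

Lemma arrangement_near M f q v : arrangement M f -> f v != 0 ->
  exists T : nat, forall t : nat, (T <= t)%N -> f (q *+ t + v) != 0.
Proof.
elim=> [_|h {}f u Mu hu _ ih /=]; first by exists 0%N.
rewrite mulf_eq0 negb_or => /andP[hv /ih{ih} [T hT]].
have [T' hT'] := affine_int_large (or_intror hv : h q != 0 \/ _).
exists (maxn T T') => t; rewrite geq_max => /andP[/hT hf /hT' hh].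
by rewrite mulf_neq0 // raddfD raddfMn -mulr_natr natz.
Qed.

Lemma unimodular_subgroup M n : unimodular M n -> subgroup M.
Proof. by case. Qed.

(** Genericity along the whole slicing only asks a point to avoid finitely many
hyperplanes. *)
Lemma unimodular_generic_slicing M n : unimodular M n ->
  exists2 f, arrangement M f &
    forall q, M q -> 0 < kappa q -> f q != 0 -> generic_slicing M q n.
Proof.
elim=> {M n} [M m Mm km Mk sM|M n d sM Md kd uz ups downs hM ih].
  exists (fun=> 1); first exact: arrangement1.
  by move=> q Mq kq _; exact: (generic_slicing0 Mm).
have /boolp.choice[F hF] j : exists F : U -> int, g j d != 0 ->
    arrangement (slice M j) F /\
    forall q, slice M j q -> 0 < kappa q -> F q != 0 ->
      generic_slicing (slice M j) q n.
  have [gd|gd] := eqVneq (g j d) 0; first by exists (fun=> 0).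
  by have [f hf hq] := ih j gd; exists f.
pose wall j q := if `[< forall u, M u -> g j u = 0 >] then 1 else g j q.
exists (fun q => (\prod_j wall j q) * \prod_(j | g j d != 0) F j (sproj d j q)).
  apply: arrangement_mul; apply: arrangement_prod => j.
    move=> _; rewrite /wall; case: asboolP => [_|]; first exact: arrangement1.
    move=> /existsNP[u /not_implyP[Mu /eqP gu]].
    rewrite (_ : (fun q => _) = (fun q => g j q * 1)).
      by apply: (arrangementM Mu) => //; exact: arrangement1.
    by apply/funext => q; rewrite mulr1.
  by move=> gd; apply: arrangement_sproj => //; exact: (hF j gd).1.
move=> q Mq kq; rewrite mulf_eq0 negb_or => /andP[/prodf_neq0 wq /prodf_neq0 Fq].
apply: (generic_slicingS sM Md) => // [j gq|j gd].
  by have := wq j isT; rewrite /wall; case: asboolP => // _ /eqP.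
have [_ hq] := hF j gd; apply: hq; rewrite ?kappa_sproj //; last exact: Fq.
exact: sproj_slice.
Qed.

(** An interior point can be moved, by scaling it up and adding a fixed vector,
to a generic interior point. *)
Lemma generic_interior_point M n q0 : unimodular M n ->
  M q0 -> 0 < kappa q0 -> (forall j, 0 < g j q0) ->
  exists q, [/\ generic_slicing M q n & forall j, 0 < g j q].
Proof.
move=> uM Mq0 kq0 gq0; have sM := unimodular_subgroup uM.
have [f af hf] := unimodular_generic_slicing uM.
have [v Mv fv] := arrangement_avoid sM af.
have [T hT] := arrangement_near q0 af fv.
pose t := (T + `|kappa v| + \sum_j `|g j v| + 1)%N.
have big (l : {additive U -> int}) : 0 < l q0 -> (`|l v| < t)%N -> 0 < l (q0 *+ t + v).
  move=> l0 lv; rewrite raddfD raddfMn -mulr_natr natz.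
  have : t%:Z <= l q0 * t%:Z by rewrite ler_peMl.
  move: (l q0 * t%:Z) (l v) lv => a b; lia.
exists (q0 *+ t + v); split; last first.
  move=> j; apply: big => //.
  by rewrite /t (bigD1 j) //=; lia.
apply: hf; last by apply: hT; rewrite /t; lia.
- by apply: subgroupD => //; rewrite pmulrn; exact: subgroupMz.
- by apply: big => //; rewrite /t; lia.
Qed.

End UnimodularSlicing.

(** * The discrete divergence theorem and reciprocity *)

Section LineIndicator.
Variables (R : numFieldType) (J : finType) (s z : J -> int).
Hypothesis s_unit : forall j, unit_or_zero (s j).

Let coincident j := #|[pred i | (s i == s j) && (z i == z j)]|.
Let tightest j := [forall i, 0 <= z i - s i * s j * z j].

Let sum_one_direction (sg : int) j0 j1 (f : int -> R) : sg * sg = 1 ->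
  s j0 = sg -> (forall j, s j = sg -> z j0 <= z j) ->
  s j1 = - sg -> (forall j, s j = - sg -> z j1 <= z j) ->
  \sum_(j | s j == sg) (coincident j)%:R^-1 * (tightest j)%:R * f (z j)
  = ([forall i, (s i == 0) ==> (0 <= z i)] && (0 <= z j0 + z j1))%:R * f (z j0).
Proof.
move=> sg1 sj0 min0 sj1 min1; set T := _ && _.
have tightE j : s j = sg -> tightest j = (z j == z j0) && T.
  move=> sj; apply/forallP/andP => [h|[/eqP zj /andP[/forallP h0 h1]] i].
    have zj : z j = z j0.
      apply/eqP; rewrite eq_le min0 // andbT.
      by have := h j0; rewrite sj0 sj sg1 mul1r subr_ge0.
    split; first exact/eqP.
    apply/andP; split.
      apply/forallP => i; apply/implyP => /eqP si.
      by have := h i; rewrite si !mul0r subr0.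
    by have := h j1; rewrite sj1 sj mulNr sg1 mulN1r opprK zj addrC.
  rewrite sj zj; have := s_unit i; rewrite /unit_or_zero !inE => si.
  have [si0|si0] := eqVneq (s i) 0.
    by have := h0 i; rewrite si0 eqxx !mul0r subr0.
  have [sisg|sisg] := eqVneq (s i) sg; first by rewrite sisg sg1 mul1r subr_ge0 min0.
  have sisN : s i = - sg by lia.
  rewrite sisN mulNr sg1 mulN1r opprK.
  by have := min1 i sisN; move: h1; lia.
under eq_bigr => j /eqP sj do rewrite tightE //.
rewrite (bigID (fun j => z j == z j0)) /= [X in _ + X]big1 ?addr0; last first.
  by move=> j /andP[_ /negbTE->]; rewrite mulr0 mul0r.
rewrite (eq_bigr (fun=> (coincident j0)%:R^-1 * (T%:R * f (z j0)))); last first.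
  move=> j /andP[/eqP sj /eqP zj]; rewrite zj eqxx mulrA; congr (_^-1 * _ * _).
  by congr _%:R; apply: eq_card => i; rewrite !inE sj zj sj0.
rewrite sumr_const -mulrnAl -mulr_natl.
rewrite (_ : #|_| = coincident j0); last first.
  by apply: eq_card => i; rewrite unfold_in /= !inE sj0.
rewrite mulfV ?mul1r // pnatr_eq0 -lt0n; apply/card_gt0P.
by exists j0; rewrite inE !eqxx.
Qed.

(** The part of the line [t |-> z + t s] on which all values are nonnegative is the
difference of two half-lines, which end at the tightest wall of either direction;
here the indicators are evaluated at [t = 0].  The projected values recognise the
tightest wall, and the factor [1 / m] accounts for walls that coincide. *)
Lemma line_indicator : (forall j, s j != 0 -> z j != 0) ->
  (exists j, s j = -1) -> (exists j, s j = 1) ->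
  ([forall j, 0 <= z j])%:R =
  \sum_(j | s j != 0) - (s j)%:~R * (coincident j)%:R^-1 * (tightest j)%:R
      * (0 < - s j * z j)%R%:R :> R.
Proof.
move=> z0 [jm /eqP sjm] [jp /eqP sjp].
case: (@arg_minP _ _ _ jm (fun j => s j == -1) z sjm) => {sjm}jm /eqP sjm minm.
case: (@arg_minP _ _ _ jp (fun j => s j == 1) z sjp) => {sjp}jp /eqP sjp minp.
have minm' j : s j = -1 -> z jm <= z j by move=> sj; apply: minm; rewrite sj.
have minp' j : s j = 1 -> z jp <= z j by move=> sj; apply: minp; rewrite sj.
rewrite (bigID (fun j => s j == 1)) /=.
rewrite (eq_bigl (fun j => s j == 1)); last first.
  by move=> j; case: eqP => [->|]; rewrite ?andbF ?andbT.
rewrite [X in _ = _ + X](eq_bigl (fun j => s j == -1)); last first.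
  by move=> j; have := s_unit j; rewrite /unit_or_zero !inE; lia.
rewrite (eq_bigr (fun j => - ((coincident j)%:R^-1 * (tightest j)%:R
    * (z j < 0)%R%:R))); last first.
  by move=> j /eqP->; rewrite mulr1z !mulN1r oppr_gt0 !mulNr.
rewrite [X in _ = _ + X](eq_bigr (fun j => (coincident j)%:R^-1 * (tightest j)%:R
    * (0 < z j)%R%:R)); last first.
  by move=> j /eqP->; rewrite mulrN1z !opprK !mul1r.
rewrite sumrN.
rewrite (@sum_one_direction 1 jp jm (fun y => (y < 0)%R%:R)) //.
rewrite (@sum_one_direction (-1) jm jp (fun y => (0 < y)%R%:R)) //.
have zm : z jm != 0 by rewrite z0 // sjm.
have zp : z jp != 0 by rewrite z0 // sjp.
have -> : [forall j, 0 <= z j] = [&& [forall i, (s i == 0) ==> (0 <= z i)],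
    0 <= z jm & 0 <= z jp].
  apply/forallP/and3P => [h|[/forallP h hm hp] j].
    by split=> //; apply/forallP => i; apply/implyP.
  have := s_unit j; rewrite /unit_or_zero !inE => /or3P[] /eqP sj.
  - exact: le_trans hm (minm' _ sj).
  - by have := h j; rewrite sj eqxx.
  - exact: le_trans hp (minp' _ sj).
rewrite [z jm + z jp]addrC.
case: [forall i, _]; rewrite /= ?mul0r ?oppr0 ?addr0 //.
case: (boolP (z jp < 0)) => p0; case: (boolP (0 < z jm)) => m0.
- rewrite !mulr1 addNr; have -> // : (0 <= z jm) && (0 <= z jp) = false by lia.
- have -> : (0 <= z jp + z jm) = false by lia.
  have -> : (0 <= z jm) && (0 <= z jp) = false by lia.
  by rewrite !mul0r oppr0 addr0.
- have -> : (0 <= z jp + z jm) by lia.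
  have -> : (0 <= z jm) && (0 <= z jp) by lia.
  by rewrite mulr0 oppr0 add0r mulr1.
- have -> : (0 <= z jm) && (0 <= z jp) = false by lia.
  by rewrite !mulr0 oppr0 addr0.
Qed.

End LineIndicator.

Lemma fsum_image (R : idomainType) (T : choiceType) (A X : set T) (h : T -> T)
    (F : T -> R) : set_inj A h -> h @` A `<=` X ->
  \sum_(v \in A) F (h v) = \sum_(u \in X) (`[< (h @` A) u >])%:R * F u.
Proof.
move=> injh AX; rewrite -(fsbig_image A h) // fsbig_mkcond [RHS]fsbig_mkcond.
apply: eq_fsbigr => u _; rewrite /patch.
case: ifPn => [/set_mem hAu|hAu]; first by rewrite mem_set ?asboolT ?mul1r //; exact: AX.
by rewrite notin_setE in hAu; case: ifP => // _; rewrite asboolF ?mul0r.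
Qed.

Section Reciprocity.
Variables (R : numFieldType) (U : zmodType) (J : finType).
Variables (kappa : {additive U -> int}) (g : J -> {additive U -> int}).
Implicit Types (M : set U) (q d u v : U) (k : int) (p F : U -> R).

Local Notation slice := (slice g).
Local Notation sproj := (sproj g).

(** A point [u] is tested after an infinitesimal move in direction [q], so that the
parts of a subdivided polytope share no point. *)
Definition half_open M q k : set U :=
  [set u | [/\ M u, kappa u = k &
            forall j, 0 < g j u \/ (g j u = 0 /\ 0 <= g j q)]].

Definition closed_points M k : set U :=
  [set u | [/\ M u, kappa u = k & forall j, 0 <= g j u]].

Lemma half_open_closed M q k : half_open M q k `<=` closed_points M k.
Proof.
by move=> u [Mu ku h]; split=> // j; case: (h j) => [/ltW|[->]].
Qed.

Lemma closed_points_slice M j k : closed_points (slice M j) k `<=` closed_points M k.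
Proof. by move=> u [[Mu _] ku h]. Qed.

Section Step.
Variables (M : set U) (d q : U).
Hypotheses (sM : subgroup M) (Md : M d) (kd : kappa d = 0).
Hypothesis uz : forall j, unit_or_zero (g j d).
Hypotheses (down : exists j, g j d = -1) (up : exists j, g j d = 1).
Hypotheses (Mq : M q) (genq : generic_in g M q).
Hypothesis gens : forall j, g j d != 0 -> generic_in g (slice M j) (sproj d j q).

(** Constraints that agree on [M] bound the same face, which is shared equally among
them. *)
Definition multiplicity j : R :=
  #|[pred i | (g i d == g j d) && `[< forall u, slice M j u -> g i u = 0 >]]|%:R.

Definition face_weight j : R := - (g j d)%:~R / multiplicity j.

(** The first integer level of [- g j d * g j] on the positive side of the wall
[j] perturbed by [q]. *)
Definition face_offset j : int := (- g j d * g j q < 0)%R : nat.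

Let lex_scale (B a b : int) : `|b| < B ->
  (0 <= B * a + b) = (0 < a) || (a == 0) && (0 <= b).
Proof. by move=> bB; case: (ltgtP a 0) => [a0|a0|->]; rewrite ?mulr0 ?add0r //=; nia. Qed.

Let scale_eq0 (B a b : int) : `|b| < B -> B * a + b = 0 -> b = 0.
Proof.
by move=> bB; case: (ltgtP a 0) => [a0|a0|->]; rewrite ?mulr0 ?add0r //; nia.
Qed.

(** Replacing [u] by [B u + q] with [B] large turns the perturbation into
honest integer values, for all faces at once. *)
Lemma half_open_indicator k u : M u -> kappa u = k ->
  (`[< half_open M q k u >])%:R =
  \sum_(j | g j d != 0) face_weight j
    * (`[< half_open (slice M j) (sproj d j q) k (sproj d j u) >])%:R
    * (face_offset j <= - g j d * g j u)%R%:R :> R.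
Proof.
move=> Mu ku.
have [B [Bq Bs]] : exists B : int, (forall i, `|g i q| < B) /\
    forall i j, `|g i (sproj d j q)| < B.
  exists (\sum_j `|g j q| + \sum_j \sum_i `|g i (sproj d j q)| + 1)%N%:Z.
  split=> [i|i j]; first by rewrite (bigD1 i) //=; lia.
  by rewrite [X in (_ + X + _)%N](bigD1 j) //= [X in (_ + (X + _) + _)%N](bigD1 i) //=; lia.
(* For this [B], the sign of [g i u'] is the sign of the pair [(g i u, g i q)] in
   lexicographic order, and likewise after projection to any wall. *)
pose u' := u *~ B + q.
have gu' i : g i u' = B * g i u + g i q.
  by rewrite raddfD raddfMz mulrzz mulrC.
have gsu' i j : g i (sproj d j u') = B * g i (sproj d j u) + g i (sproj d j q).
  rewrite (_ : sproj d j u' = sproj d j u *~ B + sproj d j q).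
    by rewrite raddfD raddfMz mulrzz mulrC.
  by rewrite /u' (raddfD (sproj d j)) (raddfMz (sproj d j)).
have gsE i j : g i (sproj d j u') = g i u' - g i d * g j d * g j u'.
  by rewrite raddfB raddfMz mulrzz mulrA.
have lexP a i v w : `|g i w| < B -> a = B * g i v + g i w ->
    0 <= a <-> 0 < g i v \/ g i v = 0 /\ 0 <= g i w.
  move=> Bw ->; rewrite lex_scale //.
  by split=> [/orP[|/andP[/eqP]]|[->//|[-> ->]]]; [left|right|].
have gq0 j : g j d != 0 -> g j q != 0.
  by apply: contra_neq => gq; exact: (genq gq).
have -> : `[< half_open M q k u >] = [forall j, 0 <= g j u'].
  apply/asboolP/forallP => [[_ _ h] j|h]; first by apply/(lexP _ _ u q).
  by split=> // j; apply/(lexP _ _ u q _ (gu' j)).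
rewrite (@line_indicator R J (fun j => g j d) (fun j => g j u')) //; last first.
  move=> j gd; rewrite gu'; apply/eqP => h.
  by have /eqP := gq0 j gd; apply; exact: scale_eq0 (Bq j) h.
apply: eq_bigr => j gd; congr (_ * _ * _).
- rewrite /face_weight /multiplicity.
  congr (_ / _%:R); apply: eq_card => i; rewrite !inE.
  have [gij|//] := eqVneq (g i d) (g j d); rewrite /=.
  have e : g i (sproj d j u') = g i u' - g j u'.
    by rewrite gsE gij (unit_sqr (uz j) gd) mul1r.
  apply/eqP/asboolP => [h|h].
    apply: (gens gd); move: e; rewrite h subrr gsu'; exact: scale_eq0.
  apply/eqP; rewrite -subr_eq0 -e; apply/eqP/h.
  apply: sproj_slice => //; apply: subgroupD => //; exact: subgroupMz.
- congr (nat_of_bool _)%:R; apply/forallP/asboolP => [h|[_ _ h] i].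
    split; [exact: sproj_slice|by rewrite kappa_sproj|move=> i].
    by apply/(lexP _ _ _ _ (Bs i j) (gsu' i j)); rewrite gsE.
  by rewrite -gsE; apply/(lexP _ _ _ _ (Bs i j) (gsu' i j)).
congr (nat_of_bool _)%:R; rewrite /face_offset gu'.
have := gq0 j gd; have := Bq j; have := uz j.
rewrite /unit_or_zero !inE (negbTE gd) /= => /orP[] /eqP->;
  move: (g j q) (g j u) => a b aB a0; rewrite ?opprK ?mul1r ?mulN1r.
- case: (ltgtP a 0) a0 => // a0 _; apply/idP/idP; nia.
- case: (ltgtP a 0) a0 => // a0 _; rewrite ?oppr_lt0 ?a0; apply/idP/idP; nia.
Qed.

Let line_inj (c : int) (A : set U) : set_inj A (fun v => v - d *~ c).
Proof. by move=> u v _ _ /addIr. Qed.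

Let image_face k j : g j d != 0 ->
  [set v - d *~ face_offset j | v in half_open (slice M j) (sproj d j q) k]
  = [set u | [/\ M u, kappa u = k,
       half_open (slice M j) (sproj d j q) k (sproj d j u)
     & - g j d * g j u = face_offset j]].
Proof.
move=> gd; have gd2 := unit_sqr (uz j) gd.
apply/seteqP; split=> [_ [v hv <-]|u [Mu ku hu cu]].
  have [[Mv gv] kv _] := hv; split.
  - by apply: sM.2 => //; exact: subgroupMz.
  - by rewrite raddfB raddfMz kd mul0rz subr0.
  - rewrite (raddfB (sproj d j)) (raddfMz (sproj d j)) /= sproj_d //.
    by rewrite mul0rz subr0 (sproj_id _ (conj Mv gv : slice M j v)).
  - by rewrite raddfB gv raddfMz mulrzz sub0r mulrNN mulrA gd2 mul1r.
exists (sproj d j u) => //.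
by rewrite -cu sprojE mulNr mulrNz opprK subrK.
Qed.

(** A line in direction [d] contributes the values of [F] at its two ends, and each
end lies next to the tightest wall, hence next to a point of a face. *)
Lemma discrete_divergence k p F :
  finite_set (closed_points M k) -> (forall u, F u - F (u - d) = p u) ->
  \sum_(u \in half_open M q k) p u =
  \sum_(j | g j d != 0) face_weight j *
    \sum_(v \in half_open (slice M j) (sproj d j q) k) F (v - d *~ face_offset j).
Proof.
move=> finK Fp.
set P := half_open M q k.
(* Summation by parts moves the difference from [F] to the indicator of [P]; the
   set [X] supports all terms that occur. *)
pose X : set U := closed_points M k `|` [set u - d | u in closed_points M k].
have finX : finite_set X by rewrite finite_setU; split=> //; exact: finite_image.
have PK : P `<=` closed_points M k := @half_open_closed M q k.
have XM u : X u -> M u /\ kappa u = k.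
  case=> [[]//|[v [Mv kv _] <-]]; split; first exact: sM.2.
  by rewrite raddfB kd subr0.
under eq_fsbigr do rewrite -Fp.
have finP : finite_set P by exact: sub_finite_set finK.
rewrite fsbig_split //=.
have := @fsum_image R U P X id F (fun _ _ _ _ => id).
rewrite image_id => -> //; last by apply: subset_trans PK _; exact: subsetUl.
have -> : \sum_(u \in P) - F (u - d) = \sum_(u \in X) (`[< P (u + d) >])%:R * - F u.
  rewrite (@fsum_image R U P X (fun u => u - d) (fun u => - F u)).
  - apply: eq_fsbigr => u _; congr ((nat_of_bool _)%:R * _); apply: asbool_equiv_eq.
    by split=> [[v Pv <-]|Pu]; [rewrite subrK|exists (u + d); rewrite ?addrK].
  - by move=> u v _ _ /addIr.
  - by move=> _ [u Pu <-]; right; exists u => //; exact: PK.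
rewrite -fsbig_split //=.
under [RHS]eq_bigr => j gd.
  rewrite (@fsum_image R U _ X (fun v => v - d *~ face_offset j) F); first last.
  - move=> _ [v hv <-]; have Kv : closed_points M k v.
      by apply: closed_points_slice; exact: half_open_closed hv.
    rewrite /face_offset; case: (_ < 0) => /=.
      by right; exists v => //; rewrite mulr1z.
    by left; rewrite mulr0z subr0.
  - exact: line_inj.
  rewrite image_face // mulr_fsumr; over.
rewrite fsbig_finite //=; under [RHS]eq_bigr do rewrite fsbig_finite //=.
rewrite [RHS]exchange_big /= big_seq [RHS]big_seq; apply: eq_bigr => u.
rewrite in_fset_set // inE => Xu; have [Mu ku] := XM u Xu.
have Mud : M (u + d) by exact: subgroupD.
have kud : kappa (u + d) = k by rewrite raddfD kd addr0.
rewrite mulrN -mulrBl half_open_indicator // half_open_indicator // -sumrB.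
rewrite mulr_suml; apply: eq_bigr => j gd.
rewrite (raddfD (sproj d j)) /= sproj_d // addr0 -mulrBr -[LHS]mulrA -[LHS]mulrA.
congr (_ * _).
rewrite mulrA; congr (_ * _).
have gd2 := unit_sqr (uz j) gd.
rewrite raddfD [- g j d * (_ + _)]mulrDr !mulNr gd2.
set h := - (g j d * g j u); set c := face_offset j.
case: (pselect (half_open (slice M j) (sproj d j q) k (sproj d j u))) => hu; last first.
  by rewrite !asboolF ?mul0r //; case.
rewrite [asbool (half_open _ _ _ _)]asboolT // mul1r.
have [hc|hc] := eqVneq h c; first last.
  rewrite [in RHS]asboolF; last by case=> _ _ _ /eqP; rewrite (negbTE hc).
  have -> : (c <= h - 1) = (c <= h) by lia.
  by rewrite subrr.
by rewrite asboolT // hc lexx (_ : (c <= c - 1) = false) ?subr0 //; lia.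
Qed.

End Step.

(** Both counts are polynomials given by the same recursion over faces: replacing
[q] by [- q] exchanges the included and excluded walls, and [u] by [- u] turns
an antiderivative into minus an antiderivative, which gives one sign per
dimension. *)
Theorem half_open_reciprocity M q n : generic_slicing kappa g M q n ->
  (forall k, 0 <= k -> finite_set (closed_points M k)) ->
  forall p, polyfun p -> exists w : {poly R},
    (forall k, 0 <= k -> \sum_(u \in half_open M q k) p u = w.[k%:~R]) /\
    (forall k, 0 < k ->
      \sum_(u \in half_open M (- q) k) p (- u) = (-1) ^+ n * w.[- k%:~R]).
Proof.
elim=> {M q n} [M q m Mm km Mk sM Mq kq|M q n d sM Md kd uz down up Mq genq hsl ih] fin p pp.
  have [w hw] := polyfun_line m pp.
  have gE j u : M u -> g j u = g j m * kappa u.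
    by move=> Mu; rewrite {1}(Mk u Mu) raddfMz mulrzz.
  have kmz k : kappa (m *~ k) = k by rewrite raddfMz km mulrzz mul1r.
  have Mmz k : M (m *~ k) by exact: subgroupMz.
  have [mpos|mneg] := boolP [forall j, 0 <= g j m]; last first.
    have {mneg} [j mj] : exists j, g j m < 0.
      by move: mneg; rewrite negb_forall => /existsP[j]; rewrite -ltNge; exists j.
    exists 0; split=> k k0; rewrite horner0 ?mulr0 fsbig1 // => u [Mu ku /(_ j)];
      rewrite ?raddfN (gE j u Mu) ku (gE j q Mq); move: (g j m) (kappa q) mj kq; nia.
  move/forallP: mpos => mpos.
  have half_openE r k : M r -> 0 <= k -> 0 < k \/ 0 <= kappa r ->
      half_open M r k = [set m *~ k].
    move=> Mr k0 kr; apply/seteqP; split=> [u [Mu ku _]|_ ->]; first by rewrite (Mk u Mu) ku.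
    split=> // j; rewrite (gE j _ (Mmz k)) kmz (gE j r Mr); have := mpos j.
    rewrite le_eqVlt => /predU1P[<-|mj]; first by right; rewrite !mul0r.
    by case: kr; move: k0 mj; move: (g j m) (kappa r) => a b; nia.
  exists w; split=> k k0.
    by rewrite half_openE // ?fsbig_set1 ?hw //; right; exact: ltW.
  rewrite half_openE ?fsbig_set1 ?(ltW k0) //; [|exact: subgroupN|by left].
  by rewrite expr0 mul1r -mulrNz hw rmorphN.
(* Any wall crossed with value [1] serves as a coordinate along [d]. *)
have [j0 gj0] := up.
have [F pF hF] := @polyfun_antiderivative R U d (g j0) gj0 p pp.
have gens j (gd : g j d != 0) := generic_slicing_generic (hsl j gd).
have fin_slice j k : 0 <= k -> finite_set (closed_points (slice M j) k).
  by move=> /fin; apply: sub_finite_set; exact: closed_points_slice.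
have /boolp.choice[w hw] j : exists w : {poly R}, g j d != 0 ->
    (forall k, 0 <= k -> \sum_(u \in half_open (slice M j) (sproj d j q) k)
       F (u - d *~ face_offset d q j) = w.[k%:~R]) /\
    (forall k, 0 < k -> \sum_(u \in half_open (slice M j) (- sproj d j q) k)
       F (- u - d *~ face_offset d q j) = (-1) ^+ n * w.[- k%:~R]).
  have [gd|gd] := boolP (g j d != 0); last by exists 0.
  have [w hw] := ih j gd (fin_slice j) _
    (polyfun_shift (- (d *~ face_offset d q j)) pF).
  by exists w.
exists (\sum_(j | g j d != 0) face_weight M d j *: w j); split=> k k0.
  rewrite (discrete_divergence sM Md kd uz down up Mq genq gens (fin k k0) hF).
  rewrite horner_sum; apply: eq_bigr => j gd; rewrite hornerZ; congr (_ * _).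
  by have [h _] := hw j gd; rewrite h.
have genN M' r : generic_in g M' r -> generic_in g M' (- r).
  by move=> gr j; rewrite raddfN => /eqP; rewrite oppr_eq0 => /eqP/gr.
rewrite (@discrete_divergence M d (- q) sM Md kd uz down up _ _ _ k
  (fun u => p (- u)) (fun u => - F (- u - d))).
- rewrite horner_sum mulr_sumr; apply: eq_bigr => j gd.
  rewrite hornerZ mulrCA; congr (_ * _); rewrite exprS -mulrA.
  have [_ <- //] := hw j gd; rewrite raddfN /= mulr_fsumr.
  apply: eq_fsbigr => v _; rewrite mulN1r; congr (- F _).
  have -> : face_offset d q j = 1 - face_offset d (- q) j.
    have gjq : g j d * g j q != 0.
      by rewrite mulf_neq0 //; apply: contra_neq gd => /genq/(_ d Md).
    rewrite /face_offset raddfN /= mulrN !mulNr opprK oppr_lt0.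
    by move: gjq; case: ltgtP.
  by rewrite mulrzBr mulr1z !opprB -addrA [RHS]addrCA.
- exact: subgroupN.
- exact: genN.
- by move=> j gd; rewrite raddfN; exact/genN/gens.
- exact/fin/ltW.
- move=> u; rewrite -hF opprK [RHS]addrC; congr (_ + F _).
  by rewrite opprB addrAC subrr add0r.
Qed.

End Reciprocity.
(** * Integer points of boxes in regular lattices *)

Section RegularLattice.
Variable E : finType.
Local Notation vec := {ffun E -> int}.
Implicit Types (L : set vec) (x d a : vec) (e : E).

(** Regular chain groups in the sense of Tutte, presented by the property that
drives every induction below: a nonzero lattice always contains a nonzero vector
[d] with entries in [{-1, 0, 1}], and remains regular when a coordinate on which
[d] does not vanish is set to zero. *)
Inductive regular : set vec -> nat -> Prop :=
| regular0 : regular [set 0] 0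
| regularS L n d of subgroup L & L d & d != 0 & (forall e, unit_or_zero (d e))
    & (forall e, d e != 0 -> regular (L `&` [set x | x e = 0]) n) :
    regular L n.+1.

Lemma ffunMz x e (k : int) : (x *~ k) e = x e * k.
Proof.
have XE n : (x *+ n) e = x e *+ n.
  by elim: n => [|n ih]; rewrite ?mulr0n ?ffunE // !mulrS ffunE ih.
case: k => n; first by rewrite -pmulrn XE -mulr_natr natz.
by rewrite NegzE mulrNz ffunE -pmulrn XE -mulr_natr natz mulrN.
Qed.

Section Box.
Variables (l u : E -> int).

Definition wall (j : E * bool) (kx : int * vec) : int :=
  if j.2 then kx.2 j.1 - l j.1 * kx.1 else u j.1 * kx.1 - kx.2 j.1.

Fact wall_is_additive j : zmod_morphism (wall j).
Proof. by case: j => e [] [k x] [k' x']; rewrite /wall /= !ffunE; ring. Qed.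
HB.instance Definition _ j :=
  GRing.isZmodMorphism.Build (int * vec)%type int (wall j) (wall_is_additive j).

Definition height : {additive (int * vec)%type -> int} := fst.

(** The shift by [a *~ k] accounts for constraints that have been made tight, which
fix a coordinate at a multiple of the height. *)
Definition cone_over a L : set (int * vec) := [set kx | L (kx.2 - a *~ kx.1)].

Lemma subgroup_cone_over a L : subgroup L -> subgroup (cone_over a L).
Proof.
move=> [L0 LB]; split=> [|[k x] [k' x']]; rewrite /cone_over /=.
  by rewrite mulr0z subr0.
by move=> h h'; rewrite mulrzBr subrACA; exact: LB.
Qed.

(** Setting one constraint of the cone tight amounts to dropping a coordinate of
the lattice, after a shift of the origin. *)
Lemma slice_cone_over a L d j : subgroup L -> L d ->
  unit_or_zero (d j.1) -> d j.1 != 0 ->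
  slice wall (cone_over a L) j =
  cone_over (a - d *~ (d j.1 * (a j.1 - (if j.2 then l else u) j.1)))
    (L `&` [set x | x j.1 = 0]).
Proof.
move=> sL Ld uz nz; set b := (if _ then l else u) _.
have gE k x : (wall j (k, x) = 0) <-> x j.1 = b * k.
  by rewrite /wall /b; case: (j) => e [] /=; split=> h; lia.
set c := d j.1 * (a j.1 - b).
have xE k x : x - (a - d *~ c) *~ k = (x - a *~ k) + d *~ (c * k).
  by rewrite mulrzBl -mulrzA opprB addrA addrAC.
have eE k x : (x - (a - d *~ c) *~ k) j.1 = x j.1 - b * k.
  rewrite xE !ffunE !ffunMz /c.
  have -> : d j.1 * (d j.1 * (a j.1 - b) * k) = d j.1 * d j.1 * ((a j.1 - b) * k) by ring.
  by rewrite unit_sqr //; ring.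
apply/seteqP; split=> [[k x]|[k x]]; rewrite /slice /cone_over /= => -[h].
  move=> /gE g0; split; last by rewrite eE g0 subrr.
  by rewrite xE; apply: subgroupD => //; exact: subgroupMz.
rewrite eE => /eqP; rewrite subr_eq0 => /eqP g0; split; last exact/gE.
rewrite -[_ - _](addrK (d *~ (c * k))) -xE; apply: sL.2 => //.
exact: subgroupMz.
Qed.

Lemma regular_unimodular L n a :
  regular L n -> unimodular height wall (cone_over a L) n.
Proof.
move=> rL; elim: rL a => {L n} [|L n d sL Ld d0 uz rL ih] a.
  apply: (@unimodular0 _ _ _ _ _ (1, a)) => //=.
  - by rewrite /cone_over /= mulr1z subrr.
  - move=> [k x]; rewrite /cone_over /= => /eqP; rewrite subr_eq0 => /eqP->.
    rewrite [RHS]surjective_pairing; congr (_, _).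
      by rewrite (raddfMz (fst : {additive (int * vec)%type -> int})) /= mulrzz mul1r.
    by rewrite (raddfMz (snd : {additive (int * vec)%type -> vec})).
  - by apply: subgroup_cone_over; split=> // y z -> ->; rewrite subrr.
have wallE j : wall j (0, d) = if j.2 then d j.1 else - d j.1.
  by rewrite /wall /=; case: j.2; rewrite mulr0 ?subr0 ?sub0r.
have [e de] : exists e, d e != 0.
  apply/existsP; apply: contra_neqT d0; rewrite negb_exists => /forallP h.
  by apply/ffunP => e; have := h e; rewrite negbK ffunE => /eqP.
have uzN z : unit_or_zero (- z) = unit_or_zero z.
  by rewrite /unit_or_zero !inE; lia.
apply: (@unimodularS _ _ _ _ _ _ (0, d)) => //=.
- exact: subgroup_cone_over.
- by rewrite /cone_over /= mulr0z subr0.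
- by move=> j; rewrite wallE; case: j.2; rewrite ?uzN.
- have := uz e; rewrite /unit_or_zero !inE (negbTE de) /= => /orP[] /eqP h.
    by exists (e, true); rewrite wallE.
  by exists (e, false); rewrite wallE /= h.
- have := uz e; rewrite /unit_or_zero !inE (negbTE de) /= => /orP[] /eqP h.
    by exists (e, false); rewrite wallE /= h.
  by exists (e, true); rewrite wallE.
move=> j dj; have {}dj : d j.1 != 0.
  by move: dj; rewrite wallE; case: j.2; rewrite ?oppr_eq0.
by rewrite (slice_cone_over a sL Ld) //; exact: ih.
Qed.

End Box.

Lemma finite_box (N : nat) : finite_set [set x : vec | forall e, `|x e| <= N%:Z].
Proof.
pose f (y : {ffun E -> 'I_(2 * N).+1}) : vec := [ffun e => (y e : nat)%:Z - N%:Z].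
apply: (@sub_finite_set _ _ (range f)); last exact/finite_image/finite_finset.
move=> x /= hx; exists [ffun e => inord (absz (x e + N%:Z))] => //.
apply/ffunP => e; rewrite !ffunE; have := hx e => {}hx.
rewrite inordK; lia.
Qed.

Lemma ncardE (R : pzRingType) (T : choiceType) (A : set T) : finite_set A ->
  (ncard A)%:R = \sum_(x \in A) (1 : R).
Proof. by move=> fA; rewrite fsbig_finite // /ncard card_fset_sum1 natr_sum. Qed.

Lemma ncard_image (T T' : choiceType) (A : set T) (h : T -> T') :
  finite_set A -> set_inj A h -> ncard (h @` A) = ncard A.
Proof.
move=> fA injh; rewrite /ncard fset_set_image // card_in_imfset //= => x y.
by rewrite !in_fset_set // => xA yA; exact: injh.
Qed.

(** Points of height [k] in the cone over the box are the points of its [k]-th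
dilation.  The point [q] witnesses that the box has an interior; otherwise the open
count could vanish when the closed one does not. *)
Theorem box_reciprocity (R : numFieldType) L n (l u : E -> int) (q : vec) (K : int) :
  regular L n -> L q -> 0 < K -> (forall e, l e * K < q e < u e * K) ->
  exists w : {poly R},
    (forall k : nat, (ncard [set x | L x /\
        forall e, l e * k%:Z <= x e <= u e * k%:Z])%:R = w.[k%:R]) /\
    (forall k : nat, (0 < k)%N -> (ncard [set x | L x /\
        forall e, l e * k%:Z < x e < u e * k%:Z])%:R = (-1) ^+ n * w.[- k%:R]).
Proof.
move=> rL Lq K0 hq.
have uL := @regular_unimodular l u L n 0 rL.
pose cone := cone_over 0 L.
have coneE k x : cone (k, x) = L x by rewrite /cone /cone_over /= mul0rz subr0.
have wallP k x : (forall j, 0 <= wall l u j (k, x)) <->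
    (forall e, l e * k <= x e <= u e * k).
  split=> [h e|h [e b]]; rewrite /wall /=.
    by have := h (e, true); have := h (e, false); rewrite /wall /=; lia.
  by have := h e; case: b; lia.
have wallP' k x : (forall j, 0 < wall l u j (k, x)) <->
    (forall e, l e * k < x e < u e * k).
  split=> [h e|h [e b]]; rewrite /wall /=.
    by have := h (e, true); have := h (e, false); rewrite /wall /=; lia.
  by have := h e; case: b; lia.
have [r [sr posr]] : exists r, generic_slicing height (wall l u) cone r n /\
    forall j, 0 < wall l u j r.
  have [||j|r [? ?]] := @generic_interior_point _ _ _ _ _ _ (K, q) uL; last by exists r.
  - by rewrite -/cone coneE.
  - by [].
  - by have /wallP' := hq; exact.
have finbox k : finite_set [set x : vec | forall e, l e * k <= x e <= u e * k].
  pose N := (\sum_e (absz (l e * k)%R + absz (u e * k)%R))%N.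
  apply: (@sub_finite_set _ _ _ _ (finite_box N)) => x h e; rewrite /N.
  have := h e; rewrite (bigD1 e) //=; lia.
have fin k : finite_set (closed_points height (wall l u) cone k).
  apply: sub_finite_set (finite_image (pair k) (finbox k)) => -[k' x] [_ /= -> h].
  by exists x => //=; apply/wallP.
have [w [wc wo]] := half_open_reciprocity sr (fun k _ => fin k)
  (polyfun_cst _ (1 : R)).
have ncard_pair k (A : set vec) (B : set (int * vec)) : finite_set A ->
    B = [set (k, x) | x in A] -> \sum_(kx \in B) (1 : R) = (ncard A)%:R.
  move=> fA ->; rewrite -ncardE; last exact: finite_image.
  by rewrite ncard_image // => x y _ _ [].
exists w; split=> k.
  rewrite -[k%:R]/((k%:Z)%:~R) -wc //; apply/esym/(ncard_pair k%:Z).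
    by apply: sub_finite_set (finbox k%:Z) => x [].
  apply/seteqP; split=> [[k' x] [cx /= -> h]|_ [x [Lx h] <-]].
    exists x => //; split; first by rewrite -(coneE k').
    apply/(wallP k%:Z) => j; case: (h j) => [/ltW|[->]] //.
  split; [by rewrite coneE|by []|].
  move=> j; have /wallP/(_ j) := h; rewrite le_eqVlt => /predU1P[/esym w0|w0].
    by right; split=> //; exact/ltW/posr.
  by left.
move=> k0; rewrite -[k%:R]/((k%:Z)%:~R) -wo //; apply/esym/(ncard_pair k%:Z).
  by apply: sub_finite_set (finbox k%:Z) => x [_ h] e; have := h e; lia.
apply/seteqP; split=> [[k' x] [cx /= -> h]|_ [x [Lx h] <-]].
  exists x => //; split; first by rewrite -(coneE k').
  apply/(wallP' k%:Z) => j; case: (h j) => [|[_]] //.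
  by rewrite raddfN oppr_ge0 leNgt posr.
split; [by rewrite coneE|by []|].
by move=> j; left; have /wallP'/(_ j) := h.
Qed.

End RegularLattice.

(** * Flows, cycles and connected components *)

Section AddEdge.
Variables (T : finType) (r r' : rel T) (u v : T).
Hypothesis r_sym : symmetric r.
Hypothesis r'E : forall x y,
  r' x y = [|| r x y, (x == u) && (y == v) | (x == v) && (y == u)].

Let r'_sym : symmetric r'.
Proof. by move=> x y; rewrite !r'E r_sym; do 4 case: eqP. Qed.

Let csym := sym_connect_sym r_sym.
Let csym' := sym_connect_sym r'_sym.

Let connect_add : subrel (connect r) (connect r').
Proof. by apply: connect_sub => x y rxy; apply: connect1; rewrite r'E rxy. Qed.

Let connect_ends : connect r' u v.
Proof. by apply: connect1; rewrite r'E !eqxx orbT. Qed.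

Let connect_addP x y : connect r' x y ->
  [|| connect r x y, connect r x u && connect r v y
    | connect r x v && connect r u y].
Proof.
move=> /connectP[p]; elim/last_ind: p y => [|p z ih] y.
  by move=> _ /= ->; rewrite connect0.
rewrite rcons_path last_rcons => /andP[/ih/(_ erefl)]; move: (last x p) => w h + ->.
rewrite r'E => /or3P[/connect1 wz|/andP[/eqP wu /eqP->]|/andP[/eqP wv /eqP->]].
- case/or3P: h => [h|/andP[-> h]|/andP[-> h]]; rewrite (connect_trans h wz) ?orbT //.
- rewrite wu in h; case/or3P: h => [->|/andP[-> _]|/andP[-> _]]; rewrite ?connect0 ?orbT //.
- rewrite wv in h; case/or3P: h => [->|/andP[-> _]|/andP[-> _]]; rewrite ?connect0 ?orbT //.
Qed.

(** A new edge whose ends are not yet connected merges their two classes: the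
roots other than that of [v] remain in bijection with the classes. *)
Lemma n_comp_add_edge : n_comp r T = (n_comp r' T + ~~ connect r u v)%N.
Proof.
case: (boolP (connect r u v)) => [uv|nuv].
  rewrite addn0; apply: eq_n_comp => x y; apply/idP/idP; first exact: connect_add.
  move=> /connect_addP/or3P[//|/andP[xu vy]|/andP[xv uy]].
    exact: connect_trans xu (connect_trans uv vy).
  by apply: connect_trans xv (connect_trans _ uy); rewrite csym.
have rootP x y : (fingraph.root r x == fingraph.root r y) = connect r x y.
  exact: root_connect.
have rootP' x y : (fingraph.root r' x == fingraph.root r' y) = connect r' x y.
  exact: root_connect.
pose A := [set x | roots r x]%SET.
have rA x : fingraph.root r x \in A by rewrite inE; exact: roots_root.
have -> : n_comp r T = #|A|.
  by apply: eq_card => x; rewrite !inE andbT.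
have -> : n_comp r' T = #|[set x | roots r' x]%SET|.
  by apply: eq_card => x; rewrite !inE andbT.
rewrite (cardsD1 (fingraph.root r v) A) rA addnC; congr (_ + _)%N.
rewrite -(@card_in_imset _ _ (fingraph.root r') (A :\ fingraph.root r v)).
  apply: eq_card => z; rewrite inE; apply/imsetP/idP => [[x _ ->]|rz].
    exact: roots_root.
  have {}rz : fingraph.root r' z = z by apply/eqP.
  have [zv|zv] := boolP (connect r z v).
    exists (fingraph.root r u).
      rewrite in_setD1 rA andbT; apply: contraNN nuv.
      by rewrite rootP.
    rewrite -{1}rz; apply/eqP; rewrite rootP'.
    apply: (connect_trans (connect_add zv)); rewrite csym'.
    apply: connect_trans connect_ends; rewrite csym'; apply/connect_add/connect_root.
  exists (fingraph.root r z); first by rewrite in_setD1 rA andbT rootP.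
  by rewrite -{1}rz; apply/eqP; rewrite rootP'; apply/connect_add/connect_root.
move=> x y /setD1P[xv xA] /setD1P[yv yA] /eqP; rewrite rootP'.
have {}xA : fingraph.root r x = x by apply/eqP; rewrite inE in xA.
have {}yA : fingraph.root r y = y by apply/eqP; rewrite inE in yA.
move=> /connect_addP/or3P[|/andP[_ vy]|/andP[vx _]].
- by rewrite -rootP xA yA => /eqP.
- by move: vy; rewrite csym -rootP yA (negbTE yv).
- by move: vx; rewrite -rootP xA (negbTE xv).
Qed.

End AddEdge.

Section GraphFlows.
Variable G : graph.
Local Notation V := (node G).
Local Notation E := (edge G).
Implicit Types (S C : {set E}) (e f : E) (u v w : V).

Lemma adj_sym S : symmetric (adj S).
Proof.
by move=> u v; apply/existsP/existsP => -[e he]; exists e; move: he; rewrite orbC.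
Qed.

Lemma connect_adjC S u v : connect (adj S) u v = connect (adj S) v u.
Proof. exact: (sym_connect_sym (@adj_sym S)). Qed.

Lemma connect_adj_sub S C : S \subset C ->
  subrel (connect (adj S)) (connect (adj C)).
Proof.
move=> /fintype.subsetP SC; apply: connect_sub => u v /existsP[e /andP[eS h]].
by apply: connect1; apply/existsP; exists e; rewrite SC.
Qed.

Lemma ncomponentsD1 S e : e \in S ->
  ncomponents (S :\ e) =
  (ncomponents S + ~~ connect (adj (S :\ e)) (ehead e) (etail e))%N.
Proof.
move=> eS; apply: n_comp_add_edge; first exact: adj_sym.
move=> x y; apply/existsP/idP => [[f /andP[fS h]]|].
  have [ef|ef] := eqVneq f e.
    apply/orP; right; rewrite -ef.
    by case/orP: h => /andP[/eqP-> /eqP->]; rewrite !eqxx ?orbT.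
  apply/orP; left; apply/existsP; exists f; rewrite !inE ef fS //.
case/orP => [/existsP[f /andP[]]|h].
  by rewrite !inE => /andP[_ fS] h; exists f; rewrite fS.
by exists e; rewrite eS /=; case/orP: h => /andP[/eqP-> /eqP->]; rewrite !eqxx ?orbT.
Qed.

(** The rank of the cycle space of the subgraph with edge set [S]. *)
Definition cycle_rank S : nat := (#|S| + ncomponents S - #|V|)%N.

Lemma ncomponents0 : ncomponents (finset.set0 : {set E}) = #|V|.
Proof.
apply: eq_card => x; rewrite inE /= andbT; apply/eqP.
have /connectP[[|y p] /=] := connect_root (adj (finset.set0 : {set E})) x => //.
by case/andP => /existsP[e]; rewrite inE.
Qed.

(** This makes the truncated subtraction in [cycle_rank] exact. *)
Lemma card_node_le S : (#|V| <= #|S| + ncomponents S)%N.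
Proof.
elim: {S}#|S| {-2}S (erefl #|S|) => [|n ih] S hS.
  by have /eqP := hS; rewrite cards_eq0 => /eqP->; rewrite ncomponents0 leq_addl.
have /card_gt0P[e eS] : (0 < #|S|)%N by rewrite hS.
have cS := cardsD1 e S; rewrite eS hS /= in cS.
have := ih (S :\ e); rewrite ncomponentsD1 // => /(_ _)/leq_trans.
move=> -/(_ _ _) h; rewrite hS; apply: h; first by lia.
by case: connect; lia.
Qed.

Lemma cycle_rankD1 S e : e \in S ->
  cycle_rank S = (cycle_rank (S :\ e) + connect (adj (S :\ e)) (ehead e) (etail e))%N.
Proof.
move=> eS; have := card_node_le (S :\ e); rewrite /cycle_rank (cardsD1 e S) eS.
by rewrite ncomponentsD1 //; case: connect => /=; lia.
Qed.

Section Cut.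
Variable A : zmodType.
Implicit Type x : {ffun E -> A}.

Lemma flow_cut x (W : pred V) : is_flow x ->
  \sum_(e | W (ehead e)) x e = \sum_(e | W (etail e)) x e.
Proof.
move=> /forallP fx.
rewrite (partition_big (@ehead G) W) //= [RHS](partition_big (@etail G) W) //=.
apply: eq_bigr => v Wv; rewrite (eq_bigl (fun e => ehead e == v)); last first.
  by move=> e; case: eqP => [->|]; rewrite ?Wv ?andbF.
rewrite (eqP (fx v)); apply: eq_bigl => e.
by case: eqP => [->|]; rewrite ?Wv ?andbF.
Qed.

(** A flow cannot use an edge whose ends are not otherwise connected in the
support: the component of one end is a cut crossed by this edge only. *)
Lemma flow_connect x S e : is_flow x -> (forall f, f \notin S -> x f = 0) ->
  x e != 0 -> connect (adj (S :\ e)) (ehead e) (etail e).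
Proof.
move=> fx xS; apply: contra_neqT => nc.
pose W := connect (adj (S :\ e)) (ehead e).
have := flow_cut W fx; rewrite big_mkcond [RHS]big_mkcond => /eqP.
rewrite -subr_eq0 -sumrB (bigD1 e) //= {1}/W connect0 (negbTE nc : W _ = false) subr0.
rewrite big1 ?addr0 => [/eqP //|f fe].
have [fS|/xS->] := boolP (f \in S); last by do 2 case: ifP; rewrite subrr.
rewrite (_ : W (ehead f) = W (etail f)) ?subrr //.
have hf : adj (S :\ e) (ehead f) (etail f).
  by apply/existsP; exists f; rewrite !inE fe fS !eqxx.
apply/idP/idP => h; apply: (connect_trans h); first exact: connect1.
by rewrite connect_adjC; exact: connect1.
Qed.

End Cut.

(** A dart [(f, b)] is the edge [f] traversed along ([b = true]) or against its
reference orientation. *)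
Definition dhead f (b : bool) := if b then ehead f else etail f.
Definition dtail f (b : bool) := if b then etail f else ehead f.
Definition dstep (D : E -> bool -> bool) : rel V := fun u v =>
  [exists f, exists b, [&& D f b, dtail f b == u & dhead f b == v]].

Definition bsign (b : bool) : int := if b then 1 else -1.

Definition divergence (x : {ffun E -> int}) v : int :=
  \sum_f x f * ((ehead f == v)%:Z - (etail f == v)%:Z).

Lemma is_flowP (x : {ffun E -> int}) : is_flow x <-> forall v, divergence x v = 0.
Proof.
have dE v : divergence x v =
    \sum_(e | ehead e == v) x e - \sum_(e | etail e == v) x e.
  rewrite big_mkcond [X in _ - X]big_mkcond -sumrB; apply: eq_bigr => f _.
  by rewrite mulrBr; do 2 case: eqP => _; rewrite ?mulr0 ?mulr1.
split=> [/forallP fx v|h]; first by rewrite dE (eqP (fx v)) subrr.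
by apply/forallP => v; rewrite -subr_eq0 -dE h.
Qed.

Definition supp (x : {ffun E -> int}) : {set E} := [set f | x f != 0]%SET.

(** The chain of a simple path; the bookkeeping of degrees and connectivity makes
the cycle obtained by closing the path up a circle. *)
Lemma simple_path_chain D u p : path (dstep D) u p -> uniq (u :: p) ->
  exists x : {ffun E -> int},
    [/\ forall f, x f != 0 -> exists2 b, x f = bsign b & D f b,
        forall f, x f != 0 -> ehead f \in u :: p /\ etail f \in u :: p,
        forall v, divergence x v = (v == last u p)%:Z - (v == u)%:Z,
        forall v, (\sum_f `|x f| * ((ehead f == v) + (etail f == v)))%N
                  = ((v \in p) + (v \in belast u p))%N
      & forall v, v \in u :: p -> connect (adj (supp x)) u v].
Proof.
elim: p u => [|w p ih] u /=.
  move=> _ _; exists 0; split=> [f|f|v|v|v]; rewrite ?ffunE ?eqxx //.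
  - by rewrite /divergence big1 ?subrr // => f _; rewrite ffunE mul0r.
  - by rewrite big1 // => f _; rewrite ffunE.
  - by rewrite mem_seq1 => /eqP->.
move=> /andP[/existsP[f /existsP[b /and3P[Df /eqP tf /eqP hf]]] hp].
move=> /andP[up wp]; have [x [x1 x2 x3 x4 x5]] := ih w hp wp.
have xf : x f = 0.
  apply: contraNeq up => /x2[]; rewrite -tf /dtail.
  by case: (b).
pose y : {ffun E -> int} := [ffun h => if h == f then bsign b else x h].
have yf : y f = bsign b by rewrite ffunE eqxx.
have yh h : h != f -> y h = x h by move=> /negbTE hf'; rewrite ffunE hf'.
have b0 : bsign b != 0 by case: (b).
have sub : supp x \subset supp y.
  apply/fintype.subsetP => h; rewrite !inE; have [->|/yh->//] := eqVneq h f.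
  by rewrite xf eqxx.
have uw : connect (adj (supp y)) u w.
  apply: connect1; apply/existsP; exists f; rewrite inE yf b0 -tf -hf /dtail /dhead.
  by case: (b); rewrite !eqxx ?orbT.
exists y; split.
- move=> h; have [->|hf'] := eqVneq h f; first by move=> _; exists b.
  by rewrite yh //; exact: x1.
- move=> h; have [->|hf'] := eqVneq h f.
    move=> _; rewrite /dhead /dtail in tf hf; case: (b) tf hf => -> ->;
    by rewrite !inE !eqxx ?orbT.
  by rewrite yh // => /x2[h1 h2]; rewrite !(in_cons u) h1 h2 !orbT.
- move=> v; rewrite /divergence (bigD1 f) //= yf.
  have -> : \sum_(i | i != f) y i * ((ehead i == v)%:Z - (etail i == v)%:Z)
      = divergence x v.
    rewrite /divergence [RHS](bigD1 f) //= xf mul0r add0r.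
    by apply: eq_bigr => h /yh->.
  rewrite x3 -tf -hf /dhead /dtail ![v == _]eq_sym.
  by case: (b); rewrite /bsign; ring.
- move=> v; rewrite (bigD1 f) //= yf.
  have -> : (\sum_(i | i != f) `|y i| * ((ehead i == v) + (etail i == v)))%N
      = (\sum_i `|x i| * ((ehead i == v) + (etail i == v)))%N.
    rewrite [RHS](bigD1 f) //= xf mul0n add0n.
    by apply: eq_bigr => h /yh->.
  rewrite x4 !inE.
  have wnp : w \notin p by case/andP: wp.
  have ub : u \notin belast w p by apply: contraNN up => /mem_belast.
  have -> : (`|bsign b| * ((ehead f == v) + (etail f == v)) = (v == w) + (v == u))%N.
    by rewrite -tf -hf /dhead /dtail ![v == _]eq_sym; case: (b); rewrite mul1n // addnC.
  have h1 : (v == w) && (v \in p) = false by case: eqP => // ->; exact: negbTE.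
  have h2 : (v == u) && (v \in belast w p) = false by case: eqP => // ->; exact: negbTE.
  move: h1 h2; case: (v == w); case: (v == u); case: (v \in p);
  by case: (v \in belast w p).
- move=> v; rewrite in_cons => /predU1P[->|/x5 wv]; first exact: connect0.
  by apply: connect_trans uw _; exact: (connect_adj_sub sub).
Qed.

(** A dart whose head is joined to its tail by other darts lies on a circle, which
carries a flow with entries in [{-1, 0, 1}]. *)
Lemma cycle_through_dart D e b : (forall c, ~~ D e c) ->
  connect (dstep D) (dhead e b) (dtail e b) ->
  exists x : {ffun E -> int},
    [/\ is_flow x, x e = bsign b,
        forall f, x f != 0 -> exists2 c, x f = bsign c & (f == e) || D f c
      & circle (supp x)].
Proof.
move=> De /connectP[p0 hp0 lp0]; move: lp0; case/shortenP: hp0 => p hp up _ lp.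
have [x [x1 x2 x3 x4 x5]] := simple_path_chain hp up.
have xe : x e = 0 by apply/eqP; apply: contraT => /x1[c _]; rewrite (negbTE (De c)).
pose y : {ffun E -> int} := [ffun h => if h == e then bsign b else x h].
have ye : y e = bsign b by rewrite ffunE eqxx.
have yh h : h != e -> y h = x h by move=> /negbTE he; rewrite ffunE he.
have b0 : bsign b != 0 by case: (b).
have sub : supp x \subset supp y.
  apply/fintype.subsetP => h; rewrite !inE; have [->|/yh->//] := eqVneq h e.
  by rewrite xe eqxx.
have head_in : dhead e b \in dhead e b :: p by rewrite inE eqxx.
have tail_in : dtail e b \in dhead e b :: p by rewrite lp mem_last.
have deg v : degree (supp y) v = (2 * (v \in dhead e b :: p))%N.
  rewrite /degree (_ : (\sum_(f in supp y) _ =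
      \sum_f `|y f| * ((ehead f == v) + (etail f == v)))%N); last first.
    rewrite big_mkcond /=; apply: eq_bigr => f _; rewrite inE.
    have [->|fe] := eqVneq f e; first by rewrite ye b0; case: (b); rewrite mul1n.
    rewrite yh //; have [->//|/x1[c -> _]] := eqVneq (x f) 0.
    by case: c; rewrite mul1n.
  rewrite (bigD1 e) //= ye.
  have -> : (\sum_(i | i != e) `|y i| * ((ehead i == v) + (etail i == v)))%N
      = (\sum_i `|x i| * ((ehead i == v) + (etail i == v)))%N.
    rewrite [RHS](bigD1 e) //= xe mul0n add0n.
    by apply: eq_bigr => h /yh->.
  rewrite x4.
  have -> : (`|bsign b| * ((ehead e == v) + (etail e == v))
      = (v == dhead e b) + (v == dtail e b))%N.
    rewrite /dhead /dtail ![v == _]eq_sym.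
    by case: (b); rewrite mul1n // addnC.
  have h1 : ((v \in belast (dhead e b) p) + (v == dtail e b) = (v \in dhead e b :: p))%N.
    have : uniq (rcons (belast (dhead e b) p) (last (dhead e b) p)) by rewrite -lastI.
    rewrite lastI -lp mem_rcons inE rcons_uniq => /andP[/negP bl _].
    by have [->|] := eqVneq v (dtail e b); [case: (boolP (_ \in _))|rewrite addn0].
  have h2 : ((v \in p) + (v == dhead e b) = (v \in dhead e b :: p))%N.
    move: up; rewrite /= inE => /andP[up _].
    by have [->|] := eqVneq v (dhead e b); [rewrite (negbTE up)|rewrite addn0].
  rewrite mul2n -addnn -{1}h2 -h1 addnACA; congr addn; exact: addnC.
exists y; split=> //.
- apply/is_flowP => v; rewrite /divergence (bigD1 e) //= ye.
  have -> : \sum_(i | i != e) y i * ((ehead i == v)%:Z - (etail i == v)%:Z)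
      = divergence x v.
    rewrite /divergence [RHS](bigD1 e) //= xe mul0r add0r.
    by apply: eq_bigr => h /yh->.
  rewrite x3 -lp /dhead /dtail ![v == _]eq_sym.
  by case: (b); rewrite /bsign; ring.
- move=> f; have [->|fe] := eqVneq f e; first by exists b.
  by rewrite yh // => /x1[c xc Dc]; exists c.
- apply/and3P; split.
  + by apply/set0Pn; exists e; rewrite inE ye.
  + by apply/forallP => v; rewrite deg; case: (_ \in _).
  + apply/'forall_forallP => u v; rewrite !deg; apply/implyP => hu; apply/implyP => hv.
    have {}hu : u \in dhead e b :: p by move: hu; case: (_ \in _).
    have {}hv : v \in dhead e b :: p by move: hv; case: (_ \in _).
    apply: (@connect_trans _ _ (dhead e b)).
      by rewrite connect_adjC; exact/(connect_adj_sub sub)/x5.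
    exact/(connect_adj_sub sub)/x5.
Qed.

(** * Regularity and rank of the flow lattices *)

Definition flows S : set {ffun E -> int} :=
  [set x | is_flow x /\ forall f, f \notin S -> x f = 0].

Lemma is_flow0 (A : zmodType) : is_flow (0 : {ffun E -> A}).
Proof. by apply/forallP => v; rewrite !big1 // => e _; rewrite ffunE. Qed.

Lemma is_flowB (A : zmodType) (x y : {ffun E -> A}) :
  is_flow x -> is_flow y -> is_flow (x - y).
Proof.
move=> /forallP fx /forallP fy; apply/forallP => v; apply/eqP.
under eq_bigr do rewrite !ffunE; under [RHS]eq_bigr do rewrite !ffunE.
by rewrite !sumrB (eqP (fx v)) (eqP (fy v)).
Qed.

Lemma subgroup_flows S : subgroup (flows S).
Proof.
split=> [|x y [fx xS] [fy yS]].
  by split=> [|f _]; [exact: is_flow0|rewrite ffunE].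
by split=> [|f fS]; [exact: is_flowB|rewrite !ffunE xS ?yS ?subrr].
Qed.

Lemma dstep_adj S : subrel (connect (adj S)) (connect (dstep (fun f _ => f \in S))).
Proof.
apply: connect_sub => u v /existsP[f /andP[fS /orP[]]] /andP[hf tf];
  apply: connect1; apply/existsP; exists f; apply/existsP.
- by exists false; rewrite /dtail /dhead fS hf tf.
- by exists true; rewrite /dtail /dhead fS hf tf.
Qed.

Lemma unit_cycle S e : e \in S -> connect (adj (S :\ e)) (ehead e) (etail e) ->
  exists x : {ffun E -> int},
    [/\ flows S x, x e = 1 & forall f, unit_or_zero (x f)].
Proof.
move=> eS /dstep_adj h.
have [|x [fx xe x1 _]] := @cycle_through_dart (fun f _ => f \in S :\ e) e true _ h.
  by move=> c; rewrite !inE eqxx.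
exists x; split=> //.
  split=> // f fS; apply/eqP; apply: contraNT fS => /x1[c _].
  by case/predU1P => [->//|]; rewrite !inE => /andP[].
move=> f; have [->|/x1[c -> _]] := eqVneq (x f) 0; first by rewrite /unit_or_zero !inE.
by case: c; rewrite /unit_or_zero !inE.
Qed.

Lemma flowsD1 S e : flows S `&` [set x | x e = 0] = flows (S :\ e).
Proof.
apply/seteqP; split=> x /=.
  move=> [[fx xS] xe]; split=> // f; rewrite !inE negb_and negbK.
  by case/predU1P => [->//|/xS].
move=> [fx xS]; split; last by apply: xS; rewrite !inE eqxx.
by split=> // f fS; apply: xS; rewrite !inE negb_and fS orbT.
Qed.

(** If no edge of [S] closes a cycle, then deleting an edge changes neither the
flows nor the rank; otherwise a cycle provides the vector [d], and each of its edges
closes a cycle, so deleting it lowers the rank by one. *)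
Theorem regular_flows S : regular (flows S) (cycle_rank S).
Proof.
elim: {S}#|S| {-2}S (erefl #|S|) => [|n ih] S hS.
  have /eqP := hS; rewrite cards_eq0 => /eqP->.
  rewrite /cycle_rank cards0 ncomponents0 subnn.
  rewrite (_ : flows _ = [set 0]); first exact: regular0.
  apply/seteqP; split=> x; last by move=> ->; exact: (subgroup_flows _).1.
  by move=> [_ xS]; apply/ffunP => f; rewrite ffunE xS // inE.
have card_D1 e : e \in S -> #|S :\ e| = n.
  by move=> eS; have := cardsD1 e S; rewrite eS hS => -[].
have [[e [eS ce]]|noc] :=
    pselect (exists e, e \in S /\ connect (adj (S :\ e)) (ehead e) (etail e)).
  have [x [[fx xS] xe x1]] := unit_cycle eS ce.
  rewrite (cycle_rankD1 eS) ce addn1.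
  apply: (@regularS _ _ _ x) => //.
  - exact: subgroup_flows.
  - by apply: contra_eq_neq xe => ->; rewrite ffunE.
  - move=> f xf; rewrite flowsD1.
    have fS : f \in S by apply: contraNT xf => /xS->.
    have cf : connect (adj (S :\ f)) (ehead f) (etail f) by exact: flow_connect xf.
    have := cycle_rankD1 fS; rewrite (cycle_rankD1 eS) ce cf !addn1 => -[->].
    exact/ih/card_D1.
have /card_gt0P[e eS] : (0 < #|S|)%N by rewrite hS.
have nce : ~~ connect (adj (S :\ e)) (ehead e) (etail e).
  by apply/negP => ce; apply: noc; exists e.
rewrite (cycle_rankD1 eS) (negbTE nce) addn0.
rewrite (_ : flows S = flows (S :\ e)); first exact/ih/card_D1.
rewrite -flowsD1; apply/esym/setIidPl => x [fx xS] /=.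
by apply/eqP; apply: contraNT nce; exact: flow_connect.
Qed.

Section GroupFlows.
Variable A : finZmodType.

Definition group_flows S : {set {ffun E -> A}} :=
  [set x | is_flow x && [forall f, (f \notin S) ==> (x f == 0)]]%SET.

Lemma group_flowsP S x :
  reflect (is_flow x /\ forall f, f \notin S -> x f = 0) (x \in group_flows S).
Proof.
rewrite inE; apply: (iffP andP) => -[fx xS]; split=> //.
  by move=> f fS; apply/eqP; have /forallP/(_ f)/implyP := xS; apply.
by apply/forallP => f; apply/implyP => /xS->.
Qed.

Let scale (d : {ffun E -> int}) (a : A) : {ffun E -> A} := [ffun f => a *~ d f].

Let scale_flow d a : is_flow d -> is_flow (scale d a).
Proof.
move=> /forallP fd; apply/forallP => v; apply/eqP.
under eq_bigr do rewrite ffunE; under [RHS]eq_bigr do rewrite ffunE.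
rewrite -(big_morph _ (mulrzDr a) (mulr0z a)) -(big_morph _ (mulrzDr a) (mulr0z a)).
by rewrite (eqP (fd v)).
Qed.

(** A flow is determined freely by its value on an edge closing a cycle and a flow
avoiding that edge. *)
Lemma card_group_flows S : #|group_flows S| = (#|A| ^ cycle_rank S)%N.
Proof.
elim: {S}#|S| {-2}S (erefl #|S|) => [|n ih] S hS.
  have /eqP := hS; rewrite cards_eq0 => /eqP->.
  rewrite /cycle_rank cards0 ncomponents0 subnn expn0.
  rewrite (_ : group_flows _ = [set (0 : {ffun E -> A})]%SET) ?cards1 //.
  apply/setP => x; apply/group_flowsP/set1P => [[_ xS]|->].
    by apply/ffunP => f; rewrite ffunE xS // inE.
  by split=> [|f _]; [exact: is_flow0|rewrite ffunE].
have card_D1 e : e \in S -> #|S :\ e| = n.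
  by move=> eS; have := cardsD1 e S; rewrite eS hS => -[].
have /card_gt0P[e eS] : (0 < #|S|)%N by rewrite hS.
rewrite (cycle_rankD1 eS).
case: (boolP (connect _ _ _)) => [ce|nce] /=; last first.
  rewrite addn0 -ih ?card_D1 //; apply: eq_card => x.
  apply/group_flowsP/group_flowsP => -[fx xS]; split=> // f.
    rewrite !inE negb_and negbK => /predU1P[->|/xS//].
    by apply/eqP; apply: contraNT nce; exact: flow_connect.
  by move=> fS; apply: xS; rewrite !inE negb_and fS orbT.
have [d [[fd dS] de d1]] := unit_cycle eS ce.
rewrite addn1 expnS -ih ?card_D1 // -cardsT -cardsX.
pose h (ay : A * {ffun E -> A}) := ay.2 - scale d (- ay.1).
have zero_e y : y \in group_flows (S :\ e) -> y e = 0.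
  by move=> /group_flowsP[_]; apply; rewrite !inE eqxx.
rewrite -(@card_in_imset _ _ h); last first.
  move=> [a y] [a' y'] /setXP[_ /= Fy] /setXP[_ /= Fy'] hh.
  have aa : a = a'.
    have := congr1 (fun x : {ffun E -> A} => x e) hh; rewrite /h /= !ffunE.
    by rewrite !zero_e // de !mulr1z !opprK !add0r.
  by move: hh; rewrite /h /= aa => /addIr ->.
apply: eq_card => x; apply/idP/imsetP.
  move=> /group_flowsP[fx xS]; exists (x e, x - scale d (x e)).
    apply/setXP; split; first by rewrite /= inE.
    apply/group_flowsP; split.
      by apply: is_flowB => //; exact: scale_flow.
    move=> f; rewrite !ffunE !inE negb_and negbK => /predU1P[->|fS].
      by rewrite de mulr1z subrr.
    by rewrite xS // dS // mulr0z subr0.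
  apply/ffunP => f; rewrite /h /= !ffunE mulNrz opprK subrK //.
move=> [[a y] /setXP[_ /= /group_flowsP[fy yS]] ->]; apply/group_flowsP; split.
  by apply: is_flowB => //; exact: scale_flow.
move=> f fS; rewrite /h /= !ffunE /= dS // mulr0z subr0.
by apply: yS; rewrite !inE negb_and fS orbT.
Qed.

End GroupFlows.
End GraphFlows.
(** * Totally cyclic orientations and nowhere-zero flows *)

Lemma ncard_indicator (R : idomainType) (T : choiceType) (A B : set T) :
  finite_set A -> B `<=` A -> (ncard B)%:R = \sum_(x \in A) ((`[< B x >])%:R : R).
Proof.
move=> fA BA; have fB : finite_set B by exact: sub_finite_set fA.
rewrite ncardE //.
have := @fsum_image R T B A id (fun=> 1 : R) (fun _ _ _ _ => id).
rewrite image_id => -> //; apply: eq_fsbigr => x _; exact: mulr1.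
Qed.

Section Orientations.
Variable G : graph.
Local Notation E := (edge G).
Implicit Types (t : orientation G) (x : {ffun E -> int}) (e f : E).

Definition signed t x e : int := if t e then x e else - x e.

Lemma signed_bsign t x e : signed t x e = bsign (t e) * x e.
Proof. by rewrite /signed; case: (t e); rewrite ?mul1r ?mulN1r. Qed.

Lemma normr_signed t x e : `|signed t x e| = `|x e|.
Proof. by rewrite /signed; case: (t e); rewrite ?normrN. Qed.

Lemma signed_term t x e (P : pred (node G)) :
  x e * ((P (ehead e))%:Z - (P (etail e))%:Z)
  = signed t x e * ((P (Defs.ohead t e))%:Z - (P (otail t e))%:Z).
Proof. by rewrite /signed /Defs.ohead /otail; case: (t e) => //; ring. Qed.

(** If the tail of [e] could not be reached from its head, the reachable nodes
would have an edge entering but none leaving, whereas a flow is balanced. *)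
Lemma positive_flow_totally_cyclic t x :
  is_flow x -> (forall e, 0 < signed t x e) -> totally_cyclic t.
Proof.
move=> fx pos; apply/forallP => e; apply/existsP.
pose D f c := (f != e) && (c == t f).
have hD : connect (dstep D) (dhead e (t e)) (dtail e (t e)).
  apply: contraT => nc; pose W := connect (dstep D) (dhead e (t e)).
  have : \sum_f x f * ((W (ehead f))%:Z - (W (etail f))%:Z) = 0.
    have /eqP := flow_cut W fx; rewrite big_mkcond [X in _ == X]big_mkcond.
    rewrite -subr_eq0 -sumrB => /eqP {2}<-; apply: eq_bigr => f _.
    by rewrite mulrBr; do 2 case: (W _); rewrite ?mulr0 ?mulr1.
  under eq_bigr do rewrite (signed_term t).
  rewrite (bigD1 e) //= => /eqP.
  have -> : W (Defs.ohead t e) by exact: connect0.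
  rewrite (negbTE nc : W (otail t e) = false) subr0 mulr1.
  rewrite gt_eqF // ltr_wpDr ?pos // sumr_ge0 // => f fe.
  apply: mulr_ge0; first exact/ltW/pos.
  case: (boolP (W (otail t f))) => [Wf|_]; last by rewrite subr0.
  rewrite (_ : W (Defs.ohead t f)) //; apply: (connect_trans Wf); apply: connect1.
  by apply/existsP; exists f; apply/existsP; exists (t f); rewrite /D fe !eqxx.
have nD c : ~~ D e c by rewrite /D eqxx.
have [y [fy ye y1 cy]] := cycle_through_dart nD hD.
exists (supp y); rewrite inE ye; apply/andP; split; first by case: (t e).
apply/andP; split => //; apply/forallP => v.
have sgn f : f \in supp y -> y f = bsign (t f).
  rewrite inE => /y1[c yc /predU1P[fe|/andP[_ /eqP <-]//]].
  by rewrite fe in yc *; rewrite ye.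
rewrite -eqz_nat -subr_eq0 !(big_morph _ PoszD (erefl 0%:Z)) -sumrB; apply/eqP.
have /is_flowP/(_ v) := fy; rewrite /divergence => {2}<-.
rewrite [RHS](bigID (mem (supp y))) /= [X in _ = _ + X]big1 ?addr0; last first.
  by move=> f; rewrite inE negbK => /eqP->; rewrite mul0r.
apply: eq_bigr => f fS; rewrite sgn // /Defs.ohead /otail.
by case: (t f); rewrite /bsign; ring.
Qed.

Lemma totally_cyclic_positive_flow t : totally_cyclic t ->
  exists2 x, is_flow x & forall e, 0 < signed t x e.
Proof.
move=> /forallP tc.
have /boolp.choice[C hC] e : exists C : {set E}, (e \in C) && oriented_cycle t C.
  exact/existsP.
pose cyc e f : int := if f \in C e then bsign (t f) else 0.
exists [ffun f => \sum_e cyc e f] => [|f].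
  apply/is_flowP => v; rewrite /divergence.
  under eq_bigr do rewrite ffunE mulr_suml.
  rewrite exchange_big big1 //= => e _.
  have /andP[_ /andP[_ /forallP/(_ v)]] := hC e.
  rewrite -eqz_nat -subr_eq0 !(big_morph _ PoszD (erefl 0%:Z)) -sumrB => /eqP.
  rewrite big_mkcond => {2}<-; apply: eq_bigr => f _; rewrite /cyc.
  case: ifP => _; last by rewrite mul0r.
  by rewrite /Defs.ohead /otail; case: (t f); rewrite /bsign; ring.
rewrite signed_bsign ffunE (bigD1 f) //= mulrDr ltr_wpDr //.
  rewrite mulr_sumr sumr_ge0 // => e _; rewrite /cyc.
  by case: ifP; rewrite ?mulr0 //; case: (t f).
by have /andP[fC _] := hC f; rewrite /cyc fC; case: (t f).
Qed.

Lemma compatibleE t x : compatible t x <-> forall e, 0 <= signed t x e.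
Proof. by split=> [/forallP|/forallP]. Qed.

Definition lower t e : int := if t e then 0 else -1.
Definition upper t e : int := if t e then 1 else 0.

Lemma lower_upper_le t x (k : int) e :
  (lower t e * k <= x e <= upper t e * k) = (0 <= signed t x e <= k).
Proof. by rewrite /lower /upper /signed; case: (t e); lia. Qed.

Lemma lower_upper_lt t x (k : int) e :
  (lower t e * k < x e < upper t e * k) = (0 < signed t x e < k).
Proof. by rewrite /lower /upper /signed; case: (t e); lia. Qed.

Lemma flowsT x : flows [set: E] x <-> is_flow x.
Proof. by split=> [[]//|fx]; split=> // f; rewrite inE. Qed.

Lemma finite_kflows k : finite_set (kflows G k).
Proof.
apply: sub_finite_set (finite_box E k) => x [_ h] e.
exact/ltW/h.
Qed.

Lemma cycle_rankT : cycle_rank [set: E] = cyclomatic G.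
Proof. by rewrite /cycle_rank cardsT. Qed.

Section Polynomial.
Variable R : numFieldType.

(** A positive flow is what makes the box of [t] have an interior. *)
Lemma orientation_polynomial t : totally_cyclic t -> exists w : {poly R},
  (forall k : nat, (ncard [set x | is_flow x /\
      forall e, 0 <= signed t x e <= k%:Z])%:R = w.[k%:R]) /\
  (forall k : nat, (0 < k)%N -> (ncard [set x | is_flow x /\
      forall e, 0 < signed t x e < k%:Z])%:R = (-1) ^+ cyclomatic G * w.[- k%:R]).
Proof.
move=> /totally_cyclic_positive_flow[q fq pos].
pose K : int := (\sum_e absz (q e)).+1%:Z.
have hq e : lower t e * K < q e < upper t e * K.
  rewrite lower_upper_lt pos /= /K (bigD1 e) //=.
  by rewrite /signed; case: (t e); lia.
have Lq : flows [set: E] q by apply/flowsT.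
have [w [wc wo]] := box_reciprocity R (regular_flows [set: E]) Lq (isT : 0 < K) hq.
rewrite cycle_rankT in wo; exists w; split=> k.
  rewrite -wc; congr (ncard _)%:R; apply/seteqP; split=> x [fx h]; split;
    try exact/flowsT; by move=> e; have := h e; rewrite lower_upper_le.
move=> k0; rewrite -wo //; congr (ncard _)%:R; apply/seteqP; split=> x [fx h]; split;
  try exact/flowsT; by move=> e; have := h e; rewrite lower_upper_lt.
Qed.

(** Nowhere-zero flows are sorted by the orientation that makes them positive,
which is then totally cyclic; reciprocity holds for each orientation. *)
Theorem nowhere_zero_polynomial : exists phi : {poly R},
  [/\ forall k : nat, (0 < k)%N -> phi.[k%:R] = (ncard (nz_kflows G k))%:R,
      forall k : nat, (-1) ^+ cyclomatic G * phi.[- k%:R] =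
        \sum_(x \in kflows G k.+1) ((num_compatible x)%:R : R)
    & (forall t, ~~ totally_cyclic t) -> phi = 0].
Proof.
have /boolp.choice[w hw] t : exists w : {poly R}, totally_cyclic t ->
    (forall k : nat, (ncard [set x | is_flow x /\
      forall e, 0 <= signed t x e <= k%:Z])%:R = w.[k%:R]) /\
    (forall k : nat, (0 < k)%N -> (ncard [set x | is_flow x /\
      forall e, 0 < signed t x e < k%:Z])%:R = (-1) ^+ cyclomatic G * w.[- k%:R]).
  have [/orientation_polynomial[w hw]|_] := boolP (totally_cyclic t); last by exists 0.
  by exists w.
exists (\sum_(t | totally_cyclic t) (-1) ^+ cyclomatic G *: (w t \Po (- 'X))).
split=> [k k0|k|no].
- have finK := finite_kflows k.
  have sub : nz_kflows G k `<=` kflows G k by move=> x [].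
  rewrite horner_sum (ncard_indicator R finK sub).
  have tE t : totally_cyclic t -> ((-1) ^+ cyclomatic G *: (w t \Po (- 'X))).[k%:R]
      = \sum_(x \in kflows G k) ((`[< forall e, 0 < signed t x e >])%:R : R).
    move=> /hw[_ wo]; rewrite hornerZ horner_comp hornerN hornerX -wo //.
    rewrite (ncard_indicator R finK); last first.
      move=> x [fx h]; split=> // e; rewrite -(normr_signed t).
      by have := h e; case: (signed t x e) => n; lia.
    apply: eq_fsbigr => x /set_mem[fx xk]; congr (nat_of_bool _)%:R.
    apply: asbool_equiv_eq; split=> [[_ h] e|h]; first by have /andP[] := h e.
    split=> // e; rewrite h /=; have := xk e; rewrite -(normr_signed t).
    by case: (signed t x e) => n; lia.
  rewrite (eq_bigr _ tE); rewrite fsbig_finite; last exact: finite_kflows.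
  under eq_bigr do rewrite fsbig_finite //=.
  rewrite exchange_big /= big_seq [RHS]big_seq; apply: eq_bigr => x.
  rewrite (in_fset_set (finite_kflows k)).
  move=> /set_mem[fx xk].
  (* The only orientation in which [x] can be positive. *)
  pose tx : orientation G := [ffun e => 0 < x e].
  case: (boolP (nowhere_zero x)) => [nz|nnz]; last first.
    rewrite asboolF; last by case=> _; apply/negP.
    rewrite big1 // => t _; rewrite asboolF // => h; move: nnz.
    rewrite negb_forall => /existsP[e]; rewrite negbK => /eqP xe.
    by have := h e; rewrite /signed xe oppr0 if_same.
  rewrite [RHS]/= asboolT //.
  have pos e : 0 < signed tx x e.
    rewrite /signed ffunE; case: ifPn => [//|]; rewrite -leNgt => xe.
    rewrite oppr_gt0 lt_neqAle xe andbT.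
    by have /forallP/(_ e) := nz.
  rewrite (bigD1 tx) /=; last exact: positive_flow_totally_cyclic pos.
  rewrite asboolT // big1 ?addr0 // => t /andP[_ /eqP ttx].
  rewrite asboolF // => h; apply: ttx; apply/ffunP => e; rewrite ffunE.
  have := h e; rewrite /signed; case: (t e) => [->//|].
  by rewrite oppr_gt0 => xe; rewrite lt_gtF.
- have finK := finite_kflows k.+1; rewrite horner_sum mulr_sumr.
  have tE t : totally_cyclic t -> (-1) ^+ cyclomatic G *
      ((-1) ^+ cyclomatic G *: (w t \Po (- 'X))).[- k%:R]
      = \sum_(x \in kflows G k.+1) ((compatible t x)%:R : R).
    move=> /hw[wc _]; rewrite hornerZ horner_comp hornerN hornerX opprK.
    rewrite mulrA -exprD addnn -mul2n exprM sqrrN !expr1n mul1r -wc.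
    rewrite (ncard_indicator R finK); last first.
      move=> x [fx h]; split=> // e; rewrite -(normr_signed t).
      by have := h e; case: (signed t x e) => n; lia.
    apply: eq_fsbigr => x /set_mem[fx xk]; congr (nat_of_bool _)%:R.
    apply/asboolP/idP => [[_ h]|/compatibleE h].
      by apply/compatibleE => e; have /andP[] := h e.
    split=> // e; rewrite h /=; have := xk e; rewrite -(normr_signed t).
    by case: (signed t x e) => n; lia.
  rewrite (eq_bigr _ tE); rewrite fsbig_finite; last exact: finite_kflows.
  under eq_bigr do rewrite fsbig_finite //=.
  rewrite exchange_big /=; apply: eq_bigr => x _.
  rewrite /num_compatible -sum1_card natr_sum big_mkcond [RHS]big_mkcond /=.
  apply: eq_bigr => t _; rewrite inE /=.
  by case: (totally_cyclic t); case: (compatible t x).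
- by rewrite big1 // => t tc; have := no t; rewrite tc.
Qed.

End Polynomial.

Lemma num_compatible0 : num_compatible (0 : {ffun E -> int}) = num_totally_cyclic G.
Proof.
apply: eq_card => t; rewrite !inE andb_idr // => _.
by apply/compatibleE => e; rewrite /signed ffunE oppr0 if_same.
Qed.

End Orientations.
(** * Counting all flows; inclusion-exclusion and modular flows *)

Lemma polyP_nat (R : numDomainType) (p q : {poly R}) :
  (forall k : nat, (0 < k)%N -> p.[k%:R] = q.[k%:R]) -> p = q.
Proof.
move=> pq; apply/eqP; rewrite -subr_eq0; apply: contraT => nz.
pose rs : seq R := [seq i.+1%:R | i <- iota 0 (size (p - q))].
have rootrs : all (root (p - q)) rs.
  apply/allP => _ /mapP[i _ ->]; rewrite rootE hornerD hornerN.
  by rewrite pq // subrr.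
have uniqrs : uniq rs.
  rewrite map_inj_uniq ?iota_uniq // => i j /eqP.
  by rewrite eqr_nat eqSS => /eqP.
by have := max_poly_roots nz rootrs uniqrs; rewrite size_map size_iota ltnn.
Qed.

Section AllFlows.
Variable G : graph.
Local Notation E := (edge G).
Implicit Types (S : {set E}) (x : {ffun E -> int}) (e f : E).

Definition kflows_on S (k : nat) : set {ffun E -> int} :=
  [set x | flows S x /\ forall e, `|x e| < k%:Z].

Lemma kflows_onT k : kflows_on [set: E] k = kflows G k.
Proof. by apply/seteqP; split=> x [fx h]; split=> //; exact/flowsT. Qed.

Lemma kflows_on_sub S k : kflows_on S k `<=` kflows G k.
Proof. by move=> x [[fx _] h]. Qed.

Lemma finite_kflows_on S k : finite_set (kflows_on S k).
Proof. by apply: sub_finite_set (finite_kflows G k); exact: kflows_on_sub. Qed.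

(** The box [-k <= x <= k] contains as many flows as [-(k+1) < x < k+1], so
reciprocity relates the counting polynomial to itself. *)
Theorem kflows_on_polynomial (R : numFieldType) S : exists p : {poly R},
  [/\ forall k : nat, (0 < k)%N -> p.[k%:R] = (ncard (kflows_on S k))%:R,
      forall t, p.[t] = (-1) ^+ cycle_rank S * p.[1 - t]
    & p.[0] = (-1) ^+ cycle_rank S].
Proof.
have [w [wc wo]] := @box_reciprocity E R (flows S) (cycle_rank S) (fun=> -1) (fun=> 1)
  0 1 (regular_flows S) (subgroup_flows S).1 isT (fun e => ltac:(by rewrite ffunE)).
pose r := (-1) ^+ cycle_rank S : R.
have rr : r * r = 1 by rewrite /r -exprD addnn -mul2n exprM sqrrN !expr1n.
have hp (k : nat) : (0 < k)%N -> (r *: (w \Po - 'X)).[k%:R] = (ncard (kflows_on S k))%:R.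
  move=> k0; rewrite hornerZ horner_comp hornerN hornerX -wo //.
  congr (ncard _)%:R; apply/seteqP; split=> x [fx h]; split=> // e;
  by have := h e; rewrite ltr_norml mulN1r mul1r.
have pw : w = (r *: (w \Po - 'X)) \Po ('X + 1).
  apply: polyP_nat => k _; rewrite [RHS]horner_comp hornerD hornerX hornerC.
  rewrite natr1 hp // -wc; congr (ncard _)%:R.
  apply/seteqP; split=> x [fx h]; split=> // e; have := h e;
    rewrite ltr_norml mulN1r mul1r; move: (x e) => z; lia.
have refl t : (r *: (w \Po - 'X)).[t] = r * (r *: (w \Po - 'X)).[1 - t].
  rewrite {1}pw hornerZ !horner_comp hornerN hornerX.
  by rewrite hornerD hornerX hornerC [- t + 1]addrC.
exists (r *: (w \Po - 'X)); split=> //.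
rewrite refl subr0 -[1 in X in _ * X](mulr1n 1) hp // (_ : kflows_on S 1 = [set 0]).
  by rewrite /ncard fset_set1 cardfs1 mulr1.
apply/seteqP; split=> [x [_ h]|_ ->].
  by apply/ffunP => e; rewrite ffunE; have := h e; move: (x e) => z; lia.
by split=> [|e]; [exact: (subgroup_flows S).1|rewrite ffunE].
Qed.

Lemma nowhere_zero_inclusion_exclusion (R : comNzRingType) (A : zmodType)
    (x : {ffun E -> A}) :
  (nowhere_zero x)%:R = \sum_(S : {set E}) (-1) ^+ #|~: S|
     * ([forall f, (f \notin S) ==> (x f == 0)])%:R :> R.
Proof.
transitivity (\prod_e (1 + (- (x e == 0)%:R)) : R).
  case: (boolP (nowhere_zero x)) => [/forallP nz|].
    by rewrite big1 // => e _; rewrite (negbTE (nz e)) subr0.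
  rewrite negb_forall => /existsP[e]; rewrite negbK => xe.
  by rewrite (bigD1 e) //= xe subrr mul0r.
rewrite bigA_distr; apply: eq_bigr => S _.
rewrite (bigID (mem S)) /= big1 ?mul1r; last by move=> e ->.
rewrite (eq_bigr (fun e => - 1 * (x e == 0)%:R)); last first.
  by move=> e /negbTE->; rewrite mulN1r.
rewrite big_split /= prodr_const; congr (_ ^+ _ * _).
  by apply: eq_card => e; rewrite inE.
case: (boolP [forall f, _]) => [/forallP h|].
  by rewrite big1 // => e eS; have /implyP/(_ eS)-> := h e.
rewrite negb_forall => /existsP[e]; rewrite negb_imply => /andP[eS xe].
by rewrite (bigD1 e) //= (negbTE xe) mul0r.
Qed.

(** The classical expansion of the modular flow polynomial over spanning
subgraphs, which proves its existence. *)
Lemma modular_flow_polyE (R : realType) : modular_flow_poly R G =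
  \sum_(S : {set E}) (-1) ^+ #|~: S| *: 'X^(cycle_rank S).
Proof.
set q := \sum_S _.
have hq (A : finZmodType) : q.[#|A|%:R] = (num_nz_flows G A)%:R.
  rewrite horner_sum /num_nz_flows.
  have termE S : ((-1) ^+ #|~: S| *: 'X^(cycle_rank S)).[#|A|%:R]
      = (-1) ^+ #|~: S| * #|group_flows A S|%:R :> R.
    by rewrite hornerZ hornerXn card_group_flows natrX.
  rewrite [LHS](eq_bigr _ (fun S _ => termE S)) -[in RHS]sum1_card natr_sum.
  rewrite [RHS]big_mkcond /=.
  rewrite [RHS](eq_bigr (fun x : {ffun E -> A} => \sum_(S : {set E})
      (-1) ^+ #|~: S| * (x \in group_flows A S)%:R)); last first.
    move=> x _; rewrite [x \in _]inE /=.
    case: (boolP (is_flow x)) => fx /=; last first.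
      by rewrite big1 // => S _; rewrite inE (negbTE fx) mulr0.
    rewrite (_ : (if _ then _ else _) = (nowhere_zero x)%:R); last by case: nowhere_zero.
    rewrite nowhere_zero_inclusion_exclusion.
    by apply: eq_bigr => S _; rewrite inE fx.
  rewrite [RHS]exchange_big /=; apply: eq_bigr => S _; rewrite -mulr_sumr; congr (_ * _).
  rewrite -sum1_card natr_sum big_mkcond /=; apply: eq_bigr => x _.
  by case: (x \in _).
rewrite /modular_flow_poly; case: xgetP => [p _ hp|/(_ q)//].
apply: polyP_nat => -[//|k] _; have hk : #|'I_k.+1| = k.+1 by rewrite card_ord.
by rewrite -hk hp hq.
Qed.

Lemma nz_kflows_inclusion_exclusion (R : idomainType) k :
  (ncard (nz_kflows G k))%:R =
  \sum_(S : {set E}) (-1) ^+ #|~: S| * (ncard (kflows_on S k))%:R :> R.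
Proof.
have finK := @finite_kflows G k.
have sub : nz_kflows G k `<=` kflows G k by move=> x [].
rewrite (ncard_indicator R finK sub).
rewrite (eq_bigr (fun S : {set E} => \sum_(x \in kflows G k)
    ((-1) ^+ #|~: S| * (`[< kflows_on S k x >])%:R : R))); last first.
  by move=> S _; rewrite (ncard_indicator R finK (@kflows_on_sub S k)) mulr_fsumr.
rewrite fsbig_finite //; under [RHS]eq_bigr do rewrite fsbig_finite //=.
rewrite [RHS]exchange_big /= big_seq [RHS]big_seq; apply: eq_bigr => x.
rewrite in_fset_set // => /set_mem[fx xk].
have -> : `[< nz_kflows G k x >] = nowhere_zero x by apply/asboolP/idP => [[]//|].
rewrite nowhere_zero_inclusion_exclusion; apply: eq_bigr => S _.
congr (_ * (nat_of_bool _)%:R); apply/forallP/asboolP => [h|[[_ xS] _] f].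
  by split=> //; split=> // f fS; have /implyP/(_ fS)/eqP := h f.
by apply/implyP => /xS->.
Qed.

End AllFlows.

(** The constant term and the value of the modular flow polynomial at [-1] are
both the alternating sum of [(-1) ^ rank] over all spanning subgraphs. *)
Lemma constant_term_modular (R : realType) (G : graph) (phi : {poly R}) :
  (forall k : nat, (0 < k)%N -> phi.[k%:R] = (ncard (nz_kflows G k))%:R) ->
  phi.[0] = (modular_flow_poly R G).[-1].
Proof.
move=> hphi.
have /boolp.choice[p hp] (S : {set edge G}) := kflows_on_polynomial R S.
have -> : phi = \sum_(S : {set edge G}) (-1) ^+ #|~: S| *: p S.
  apply: polyP_nat => k k0; rewrite hphi // nz_kflows_inclusion_exclusion horner_sum.
  by apply: eq_bigr => S _; rewrite hornerZ; have [-> //] := hp S.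
rewrite modular_flow_polyE !horner_sum; apply: eq_bigr => S _.
by rewrite !hornerZ hornerXn; have [_ _ ->] := hp S.
Qed.
(** * Growth of polynomials and of the number of flows *)

Section Growth.
Variable R : realType.
Implicit Types (p r : {poly R}) (n m : nat).

(** The factor [k] on the left avoids the exponent [n - 1], so that [n = 0], where
[r = 0], is no exception. *)
Lemma horner_lower_order r n : (size r <= n)%N ->
  exists2 C, 0 <= C & forall k : nat, (0 < k)%N -> `|r.[k%:R]| * k%:R <= C * k%:R ^+ n.
Proof.
move=> rn; exists (\sum_(i < size r) `|r`_i|) => [|k k0]; first exact: sumr_ge0.
rewrite horner_coef; apply: le_trans (ler_wpM2r _ (ler_norm_sum _ _ _)) _ => //.
rewrite !mulr_suml; apply: ler_sum => i _.
rewrite normrM normrX normr_nat -mulrA -exprSr ler_wpM2l //.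
by rewrite ler_weXn2l ?ler1n // (leq_trans _ rn).
Qed.

Lemma leading_split p n : (size p <= n.+1)%N ->
  exists2 r : {poly R}, (size r <= n)%N & p = p`_n *: 'X^n + r.
Proof.
move=> pn; exists (p - p`_n *: 'X^n); last by rewrite addrC subrK.
apply/leq_sizeP => j; rewrite leq_eqVlt coefB coefZ coefXn => /predU1P[<-|nj].
  by rewrite eqxx mulr1 subrr.
by rewrite gtn_eqF // mulr0 subr0 nth_default // (leq_trans pn).
Qed.

Lemma unbounded_multiples (a C : R) (k0 : nat) : 0 < a ->
  exists2 k : nat, (k0 < k)%N & C < a * k%:R.
Proof.
move=> a0; have := archi_boundP (normr_ge0 (C / a)).
set k := Num.bound _ => hk; exists (k0 + k).+1; first by rewrite ltnS leq_addr.
rewrite mulrC -ltr_pdivrMr //; apply: le_lt_trans (ler_norm _) _.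
by apply: lt_le_trans hk _; rewrite ler_nat -addnS addnC addSn leqW // leq_addr.
Qed.

Lemma size_le_growth p m (C : R) :
  (forall k : nat, (0 < k)%N -> `|p.[k%:R]| <= C * k%:R ^+ m) -> (size p <= m.+1)%N.
Proof.
move=> hp; rewrite leqNgt; apply/negP => sp.
pose s := (size p).-1; have ss : size p = s.+1 by rewrite prednK // (leq_ltn_trans _ sp).
have [r rs pE] := leading_split (eq_leq ss).
have a0 : 0 < `|p`_s|.
  by rewrite normr_gt0 -[s]/((size p).-1) -lead_coefE lead_coef_eq0 -size_poly_eq0 ss.
have [C' C'0 hr] := horner_lower_order rs.
have [k k0] := unbounded_multiples (`|C| + C') 0 a0; rewrite ltNge => /negP; apply.
have kk : 0 < k%:R :> R by rewrite ltr0n.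
rewrite -(ler_pM2r (exprn_gt0 s kk)).
have -> : `|p`_s| * k%:R * k%:R ^+ s = `|p.[k%:R] - r.[k%:R]| * k%:R.
  by rewrite {2}pE hornerD addrK hornerZ hornerXn normrM normrX normr_nat mulrAC.
apply: le_trans (ler_wpM2r (ltW kk) (ler_normB _ _)) _; rewrite !mulrDl.
apply: lerD; last exact: hr.
apply: le_trans (ler_wpM2r (ltW kk) (hp k k0)) _.
rewrite -mulrA -exprSr.
apply: (@le_trans _ _ (`|C| * k%:R ^+ m.+1)).
  by apply: ler_wpM2r (ler_norm _); apply/exprn_ge0/ltW.
by rewrite ler_wpM2l // ler_weXn2l ?ler1n // -ltnS -ss.
Qed.

Lemma coef_ge0_growth p n (k0 : nat) : (size p <= n.+1)%N ->
  (forall k : nat, (k0 <= k)%N -> 0 <= p.[k%:R]) -> 0 <= p`_n.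
Proof.
move=> pn hp; rewrite leNgt; apply/negP => an.
have [r rn pE] := leading_split pn; have [C C0 hr] := horner_lower_order rn.
have an' : 0 < - p`_n by rewrite oppr_gt0.
have [k kk0] := unbounded_multiples C k0 an'; rewrite ltNge => /negP; apply.
have kk : 0 < k%:R :> R by rewrite ltr0n (leq_ltn_trans _ kk0).
rewrite -(ler_pM2r (exprn_gt0 n kk)).
apply: (le_trans _ (hr k (leq_ltn_trans (leq0n _) kk0))).
rewrite mulrAC; apply: ler_wpM2r; first exact: ltW.
apply: (le_trans _ (ler_norm _)).
rewrite -subr_ge0 mulNr opprK addrC; have := hp k (ltnW kk0).
by rewrite {1}pE hornerD hornerZ hornerXn.
Qed.

(** A counting polynomial squeezed between two shifts of [v k ^ n] has leading
term [v X ^ n]. *)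
Lemma leading_term_squeeze p n (v : R) (B : nat) : 0 < v ->
  (forall k : nat, (0 < k)%N -> 0 <= p.[k%:R] <= v * (k + B)%:R ^+ n) ->
  (forall k : nat, (B < k)%N -> v * (k - B)%:R ^+ n <= p.[k%:R]) ->
  lead_coef p = v /\ size p = n.+1.
Proof.
move=> v0 hup hlow.
have sp : (size p <= n.+1)%N.
  apply: (@size_le_growth _ _ (v * (1 + B)%:R ^+ n)) => k k0.
  have /andP[p0 pk] := hup k k0; rewrite ger0_norm //; apply: le_trans pk _.
  rewrite -mulrA; apply: ler_wpM2l; first exact: ltW.
  rewrite -exprMn lerXn2r ?nnegrE ?mulr_ge0 //.
  by rewrite -natrM ler_nat mulnDl mul1n leq_add2l leq_pmulr.
have XsubE c : (('X - c%:P) ^+ n : {poly R})`_n = 1.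
  have := monic_exp n (monicXsubC c); rewrite monicE lead_coefE.
  by rewrite size_exp_XsubC => /eqP.
have szX c : (size (v *: ('X - c%:P) ^+ n : {poly R}) <= n.+1)%N.
  by rewrite size_scale ?gt_eqF // size_exp_XsubC.
have hv c : (v *: ('X - c%:P) ^+ n : {poly R})`_n = v by rewrite coefZ XsubE mulr1.
have pn : p`_n = v.
  apply/eqP; rewrite eq_le; apply/andP; split; rewrite -subr_ge0.
    have := @coef_ge0_growth (v *: ('X - (- B%:R)%:P) ^+ n - p) n 1.
    rewrite coefB hv; apply.
      by rewrite (leq_trans (size_polyD _ _)) // geq_max szX size_polyN.
    move=> k k0; rewrite hornerD hornerN subr_ge0 hornerZ horner_exp hornerXsubC.
    by rewrite opprK -natrD; have /andP[] := hup k k0.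
  have := @coef_ge0_growth (p - v *: ('X - (B%:R)%:P) ^+ n) n B.+1.
  rewrite coefB hv; apply.
    by rewrite (leq_trans (size_polyD _ _)) // geq_max size_polyN szX andbT.
  move=> k Bk; rewrite hornerD hornerN subr_ge0 hornerZ horner_exp hornerXsubC.
  by rewrite -natrB 1?ltnW // hlow.
have szp : size p = n.+1.
  apply/eqP; rewrite eqn_leq sp ltnNge; apply/negP => /leq_sizeP/(_ n (leqnn _)).
  by rewrite pn => v00; rewrite v00 ltxx in v0.
by rewrite lead_coefE szp pn.
Qed.

End Growth.

Section FlowGrowth.
Variable G : graph.
Local Notation E := (edge G).
Implicit Types (S : {set E}) (x : {ffun E -> int}) (e f : E).

(** Reduction modulo [2 k] is injective on vectors with entries between [-k] and
[k], so there are at most as many flows as modular ones. *)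
Lemma ncard_kflows_on_le S k : (0 < k)%N ->
  (ncard (kflows_on S k) <= (2 * k) ^ cycle_rank S)%N.
Proof.
move=> k0; set p := (2 * k)%N; have p1 : (1 < p)%N by rewrite /p; lia.
pose red x : {ffun E -> 'Z_p} := [ffun e => (x e)%:~R].
have small (z : int) : `|z| < p%:Z -> z%:~R = 0 :> 'Z_p -> z = 0.
  have nat_small n : (n < p)%N -> n%:R = 0 :> 'Z_p -> n = 0%N.
    by move=> np /(congr1 val); rewrite /= val_Zp_nat // modn_small.
  case: z => n; first by rewrite -pmulrn => h /nat_small -> //; lia.
  rewrite NegzE mulrNz -pmulrn => h /eqP; rewrite oppr_eq0 => /eqP/nat_small.
  by move=> -> //; lia.
have inj : set_inj (kflows_on S k) red.
  move=> x y /set_mem[_ xk] /set_mem[_ yk] xy; apply/ffunP => e.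
  apply/eqP; rewrite -subr_eq0; apply/eqP/small.
    have := xk e; have := yk e; rewrite /p; move: (x e) (y e) => a b; lia.
  have : red x e = red y e by rewrite xy.
  by rewrite rmorphB !ffunE => /eqP; rewrite -subr_eq0 => /eqP.
have cardZ : #|'Z_p| = p by rewrite card_ord Zp_cast.
rewrite -(ncard_image (finite_kflows_on S k) inj) -[X in (X ^ _)%N]cardZ.
rewrite -(card_group_flows 'Z_p S) cardE /ncard; apply: uniq_leq_size => [|y].
  exact: fset_uniq.
have fin_im : finite_set (red @` kflows_on S k).
  exact/finite_image/finite_kflows_on.
rewrite in_fset_set // => /set_mem[x [[fx xS] _] <-]; rewrite mem_enum.
apply/group_flowsP; split=> [|f fS]; last by rewrite ffunE xS.
apply/forallP => v; have /forallP/(_ v)/eqP := fx => fxv.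
under eq_bigr do rewrite ffunE; under [X in _ == X]eq_bigr do rewrite ffunE.
by rewrite -!(rmorph_sum (intmul 1 : {rmorphism int -> 'Z_p})) fxv.
Qed.

Lemma cycle_rank_sub S S' : S \subset S' -> (cycle_rank S <= cycle_rank S')%N.
Proof.
move=> /fintype.subsetP sub; rewrite -(@leq_exp2l 2) //.
have := card_group_flows 'I_2 S; have := card_group_flows 'I_2 S'.
rewrite card_ord => <- <-; apply/subset_leq_card/fintype.subsetP => x.
move=> /group_flowsP[fx xS]; apply/group_flowsP; split=> // f fS'.
by apply: xS; apply: contraNN fS' => /sub.
Qed.

Lemma isthmusE e : isthmus e = ~~ connect (adj ([set: E] :\ e)) (ehead e) (etail e).
Proof.
rewrite /isthmus -finset.setTD ncomponentsD1 ?inE //.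
by case: connect; rewrite ?addn0 ?ltnn // addn1 ltnSn.
Qed.

Lemma isthmus_not_totally_cyclic e (t : orientation G) : isthmus e -> ~~ totally_cyclic t.
Proof.
rewrite isthmusE; apply: contraNN => /totally_cyclic_positive_flow[x fx pos].
apply: (flow_connect fx) => [f|]; first by rewrite inE.
by apply: contraTneq (pos e) => xe; rewrite /signed xe oppr0 if_same.
Qed.

End FlowGrowth.
(** * Volume by counting grid cells *)

Section GridVolume.
Import HBNNSimple.
Variable R : realType.
Local Open Scope ereal_scope.

(** Comparing integrals of nonnegative functions needs no measurability: the
integral is a supremum over the simple functions below.  This spares any
discussion of the measurability of the sections of a polytope. *)
Lemma le_integral_nonneg d (T : measurableType d) (mu : {measure set T -> \bar R})
    (f g : T -> \bar R) : (forall x, 0 <= f x) -> (forall x, f x <= g x) ->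
  \int[mu]_x f x <= \int[mu]_x g x.
Proof.
move=> f0 fg; have g0 x : 0 <= g x by exact: le_trans (f0 x) (fg x).
rewrite (ge0_integralTE _ f0) (ge0_integralTE _ g0); apply: ereal_sup_le => _ [h hf <-].
by exists h => // x; exact: le_trans (hf x) (fg x).
Qed.

Lemma lebesgue_volS n (A : set (n.+1.-tuple R)) : lebesgue_vol A =
  \int[lebesgue_measure]_r lebesgue_vol [set t : n.-tuple R | A [tuple of r :: t]].
Proof.
rewrite /= /pushforward /product_measure1; apply: eq_integral => r _ /=.
congr (lebesgue_vol _); apply/seteqP; split=> t; rewrite /xsection /=.
  by move=> /set_mem.
by move=> At; apply/mem_set.
Qed.

Lemma lebesgue_vol_ge0 n (A : set (n.-tuple R)) : 0 <= lebesgue_vol A.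
Proof.
elim: n A => [|n ih] A; first by rewrite /= diracE lee_fin.
by rewrite lebesgue_volS; apply: integral_ge0 => r _; exact: ih.
Qed.

Variable h : R.
Hypothesis h0 : (0 < h)%R.

Definition slab (z : int) : set R := [set` `[(z%:~R * h)%R, ((z + 1)%:~R * h)%R[].

Lemma slabP z r : slab z r <-> Num.floor (r / h)%R = z.
Proof.
rewrite /slab /= in_itv /= -ler_pdivlMr // -ltr_pdivrMr //.
by split=> [/floor_def//|<-]; exact: floor_itv.
Qed.

Lemma lebesgue_slab z : lebesgue_measure (slab z) = h%:E.
Proof.
rewrite lebesgue_measure_itv /= lte_fin ltr_pM2r // ltr_int ltrDl ltr01.
by rewrite -EFinD -mulrBl -rmorphB /= addrAC subrr add0r mul1r.
Qed.

Definition cell n (x : n.-tuple R) : n.-tuple int :=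
  map_tuple (fun r => Num.floor (r / h)%R) x.

Lemma cell_cons n r (t : n.-tuple R) :
  cell [tuple of r :: t] = [tuple of Num.floor (r / h)%R :: cell t].
Proof. exact/val_inj. Qed.

Let step n (Y : seq (n.+1.-tuple int)) (c : R) (r : R) : \bar R :=
  \sum_(y <- Y) (c * \1_(slab (thead y)) r)%:E.

Let stepE n (Y : seq (n.+1.-tuple int)) c r : step Y c r =
  ((size [seq y <- Y | thead y == Num.floor (r / h)%R])%:R * c)%:E.
Proof.
rewrite /step sumEFin; congr (_%:E); rewrite size_filter.
rewrite -sum1_count natr_sum mulr_suml [RHS]big_mkcond; apply: eq_bigr => y _.
rewrite indicE; case: eqP => [->|ne].
  by rewrite mem_set ?mulr1 ?mul1r //; exact/slabP.
by rewrite memNset ?mulr0 // => /slabP e; apply: ne.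
Qed.

Let integral_step n (Y : seq (n.+1.-tuple int)) (c : R) : (0 <= c)%R ->
  \int[lebesgue_measure]_r step Y c r = ((size Y)%:R * (h * c))%:E.
Proof.
move=> c0; have mI z : measurable (slab z) by exact: measurable_itv.
rewrite ge0_integral_sum //; last 2 first.
- move=> y; apply/measurable_EFinP; apply: measurable_funM => //.
  exact: (measurable_indic (mI _)).
- by move=> y r _; rewrite lee_fin mulr_ge0.
rewrite (eq_bigr (fun=> (h * c)%:E)) => [|y _].
  by rewrite sumEFin big_const_seq count_predT iter_addr addr0 mulr_natl.
rewrite (@integralZl_indic _ _ _ lebesgue_measure setT measurableT (fun=> slab (thead y))).
- rewrite integral_indic; last exact: mI.
  rewrite (_ : slab _ `&` _ = slab (thead y)); last first.
    by apply/seteqP; split=> [x []//|x]; split.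
  by rewrite [X in _ * X]lebesgue_slab -EFinM mulrC.
- exact: measurableT.
- by move=> /(le_lt_trans c0); rewrite ltxx.
- exact: mI.
Qed.

Let behead_filter n (Y : seq (n.+1.-tuple int)) (z : int) : seq (n.-tuple int) :=
  [seq behead_tuple y | y <- Y & thead y == z].

Lemma vol_le_cells n (Y : seq (n.-tuple int)) (A : set (n.-tuple R)) :
  (forall x, A x -> cell x \in Y) ->
  lebesgue_vol A <= ((size Y)%:R * h ^+ n)%:E.
Proof.
elim: n Y A => [|n ih] Y A AY.
  rewrite /= diracE lee_fin expr0 mulr1 ler_nat; case: (boolP (_ \in A)) => // /set_mem/AY.
  by case: Y {AY}.
have hn : (0 <= h ^+ n)%R by rewrite exprn_ge0 // ltW.
rewrite lebesgue_volS exprS -(integral_step Y hn).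
apply: le_integral_nonneg => r; first exact: lebesgue_vol_ge0.
rewrite stepE -(size_map (@behead_tuple _ _)).
apply: (ih (behead_filter Y (Num.floor (r / h)))) => t /AY hY.
apply/mapP; exists (cell [tuple of r :: t]); last by apply/val_inj.
by rewrite mem_filter hY andbT cell_cons theadE.
Qed.

Lemma cells_le_vol n (Y : seq (n.-tuple int)) (A : set (n.-tuple R)) :
  uniq Y -> (forall x, cell x \in Y -> A x) ->
  ((size Y)%:R * h ^+ n)%:E <= lebesgue_vol A.
Proof.
elim: n Y A => [|n ih] Y A uY YA.
  rewrite /= diracE lee_fin expr0 mulr1 ler_nat.
  case: Y uY YA => [//|y [|y' Y]]; last first.
    by rewrite cons_uniq (tuple0 y) (tuple0 y') mem_head.
  move=> _ YA; rewrite mem_set //; apply: YA.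
  by rewrite (tuple0 y) inE; apply/eqP/val_inj.
have hn : (0 <= h ^+ n)%R by rewrite exprn_ge0 // ltW.
rewrite lebesgue_volS exprS -(integral_step Y hn).
apply: le_integral_nonneg => r; rewrite stepE.
  by rewrite lee_fin mulr_ge0.
rewrite -(size_map (@behead_tuple _ _)).
apply: (ih (behead_filter Y (Num.floor (r / h)))) => [|t].
  rewrite map_inj_in_uniq ?filter_uniq // => y y'; rewrite !mem_filter.
  case/tupleP: y => a y; case/tupleP: y' => a' y'; rewrite !theadE.
  move=> /andP[/eqP-> _] /andP[/eqP-> _] /(congr1 val) /= yy'.
  by apply/val_inj => /=; rewrite yy'.
move=> /mapP[y]; rewrite mem_filter => /andP[/eqP yr yY] ty; apply: YA.
suff -> : cell [tuple of r :: t] = y by [].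
case/tupleP: y yr yY ty => a y; rewrite theadE => -> _ /(congr1 val) /= ty.
by apply/val_inj => /=; rewrite -ty.
Qed.

End GridVolume.
(** * Lattice bases and the leading coefficient *)

Section LatticeBasis.
Variables (R : realType) (T : finType).
Local Notation rvec := {ffun T -> R}.

Lemma lincombB n (b : n.-tuple rvec) (y z : 'I_n -> R) :
  lincomb b (fun i => y i - z i) = lincomb b y - lincomb b z.
Proof.
apply/ffunP => e; rewrite !ffunE -sumrB; apply: eq_bigr => i _.
by rewrite mulrBl.
Qed.

Lemma lincombZ n (b : n.-tuple rvec) (a : R) (y : 'I_n -> R) e :
  lincomb b (fun i => a * y i) e = a * lincomb b y e.
Proof.
by rewrite !ffunE mulr_sumr; apply: eq_bigr => i _; rewrite mulrA.
Qed.

Lemma lincomb_cons n (v : rvec) (b : n.-tuple rvec) (y : 'I_n.+1 -> R) e :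
  lincomb [tuple of v :: b] y e =
  y ord0 * v e + lincomb b (fun i => y (lift ord0 i)) e.
Proof.
rewrite !ffunE big_ord_recl /= tnth0; congr (_ + _).
by apply: eq_bigr => i _; rewrite tnthS.
Qed.

Lemma lattice_basis_mem (L : set rvec) n (b : n.-tuple rvec) i :
  lattice_basis L b -> L (tnth b i).
Proof.
case=> _ ->; exists (fun j => (j == i)%:Z) => //.
apply/ffunP => e; rewrite ffunE (bigD1 i) //= eqxx mul1r big1 ?addr0 // => j ji.
by rewrite (negbTE ji) mul0r.
Qed.

Definition realify (x : {ffun T -> int}) : rvec := [ffun e => (x e)%:~R].

Lemma realify_inj : injective realify.
Proof.
move=> x y /ffunP h; apply/ffunP => e; have := h e; rewrite !ffunE => /eqP.
by rewrite eqr_int => /eqP.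
Qed.

(** As [d e] is a unit, the lattice is the direct sum of the multiples of [d] and of
the vectors vanishing at [e]; the coordinate [e] also shows independence over the
reals. *)
Lemma regular_basis (L : set {ffun T -> int}) n : regular L n ->
  exists b : n.-tuple rvec, lattice_basis (realify @` L) b.
Proof.
elim=> {L n} [|L n d sL Ld d0 uz _ ih].
  exists [tuple]; split=> [y _ []//|]; apply/seteqP; split=> [_ [x -> <-]|_ [z _ <-]].
    by exists (fun=> 0) => //; apply/ffunP => e; rewrite !ffunE big_ord0.
  by exists 0 => //; apply/ffunP => e; rewrite !ffunE big_ord0.
have [e de] : exists e, d e != 0.
  apply/existsP; apply: contra_neqT d0; rewrite negb_exists => /forallP h.
  by apply/ffunP => e; have := h e; rewrite negbK ffunE => /eqP.
have [b hb] := ih e de; have [bfree bspan] := hb.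
have be y : lincomb b y e = 0.
  rewrite ffunE big1 // => i _.
  have [x [_ /= xe] <-] := lattice_basis_mem i hb.
  by rewrite ffunE xe mulr0.
exists [tuple of realify d :: b]; split=> [y /ffunP hy|].
  have y0 : y ord0 = 0.
    have := hy e; rewrite lincomb_cons be addr0 !ffunE => /eqP.
    by rewrite mulf_eq0 intr_eq0 (negbTE de) orbF => /eqP.
  have y1 : lincomb b (fun i => y (lift ord0 i)) = 0.
    apply/ffunP => f; have := hy f; rewrite lincomb_cons y0 mul0r add0r => ->.
    by rewrite !ffunE.
  by move=> i; case: (unliftP ord0 i) => [j ->|->] //; exact: bfree y1 j.
apply/seteqP; split=> [_ [x Lx <-]|_ [z _ <-]].
  pose c := d e * x e; pose x' := x - d *~ c.
  have Lx' : (L `&` [set x | x e = 0]) x'.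
    split; first by apply: sL.2 => //; exact: subgroupMz.
    by rewrite /= !ffunE ffunMz /c mulrA unit_sqr // mul1r subrr.
  have : (realify @` (L `&` [set x | x e = 0])) (realify x') by exists x'.
  rewrite bspan => -[z' _ hz'].
  exists (fun i => if unlift ord0 i is Some j then z' j else c) => //.
  apply/ffunP => f; rewrite lincomb_cons unlift_none.
  rewrite (_ : lincomb b _ = realify x'); last first.
    by rewrite -hz'; apply/ffunP => f'; rewrite !ffunE; apply: eq_bigr => i _; rewrite liftK.
  by rewrite !ffunE ffunMz -intrM -rmorphD /= mulrC addrC subrK.
have : [set lincomb b (fun i => (z i)%:~R) | z in [set: 'I_n -> int]]
    (lincomb b (fun i => (z (lift ord0 i))%:~R)) by exists (z \o lift ord0).
rewrite -bspan => -[x' [Lx' _] hx'].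
exists (d *~ z ord0 + x'); first by apply: subgroupD => //; exact: subgroupMz.
apply/ffunP => f; rewrite lincomb_cons -hx' !ffunE ffunMz.
by rewrite rmorphD rmorphM mulrC.
Qed.

End LatticeBasis.
Arguments realify R {T} x.

Section FlowVolume.
Variables (R : realType) (G : graph).
Local Notation E := (edge G).
Implicit Types (x : {ffun E -> int}) (e f : E).

Lemma realify_flow x : is_flow (realify R x) = is_flow x.
Proof.
apply: eq_forallb => v; under eq_bigr do rewrite ffunE.
under [X in _ == X]eq_bigr do rewrite ffunE.
by rewrite -!(rmorph_sum (intmul 1 : {rmorphism int -> R})) eqr_int.
Qed.

Lemma flow_latticeE : flow_lattice R G = realify R @` flows [set: E].
Proof.
apply/seteqP; split=> [y [fy yint]|_ [x /flowsT fx <-]]; last first.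
  by split=> [|e]; [rewrite /cycle_space /= realify_flow|rewrite ffunE intr_int].
have yE : y = realify R [ffun e => Num.floor (y e)].
  by apply/ffunP => e; rewrite !ffunE; apply/esym/eqP; rewrite -intrEfloor.
by exists [ffun e => Num.floor (y e)] => //; apply/flowsT; rewrite -realify_flow -yE.
Qed.

Lemma lincomb_flow n (b : n.-tuple {ffun E -> R}) (y : 'I_n -> R) :
  (forall i, is_flow (tnth b i)) -> is_flow (lincomb b y).
Proof.
move=> fb; apply/forallP => v; apply/eqP.
under eq_bigr do rewrite ffunE; under [RHS]eq_bigr do rewrite ffunE.
rewrite exchange_big [RHS]exchange_big /=; apply: eq_bigr => i _.
by rewrite -!mulr_sumr; have /forallP/(_ v)/eqP-> := fb i.
Qed.

(** In coordinates, rounding to the grid of mesh [1 / k] moves a point of the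
dilated polytope by a bounded amount [B], so the volume of the polytope lies
between the numbers of integer points of two dilations, times [k ^ - n]. *)
Theorem basis_leading_term n (b : n.-tuple {ffun E -> R}) (p : {poly R}) :
  lattice_basis (flow_lattice R G) b ->
  (forall k : nat, (0 < k)%N -> p.[k%:R] = (ncard (kflows G k))%:R) ->
  has_leading_term p (lebesgue_vol
    [set y : n.-tuple R | flow_polytope R G (lincomb b (tnth y))]) n.
Proof.
move=> hb hp; have [bfree bspan] := hb.
have fb i : is_flow (tnth b i) by have [] := lattice_basis_mem i hb.
set A := [set y | _].
pose zcomb (z : n.-tuple int) := lincomb b (fun i => (tnth z i)%:~R).
pose Y (k : nat) : set (n.-tuple int) := [set z | forall e, `|zcomb z e| <= k%:R].
have zcomb_inj z z' : zcomb z = zcomb z' -> z = z'.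
  move=> zz; apply: eq_from_tnth => i; apply/eqP.
  rewrite -(eqr_int R) -subr_eq0; apply/eqP.
  apply: (bfree (fun i => (tnth z i)%:~R - (tnth z' i)%:~R)).
  by rewrite lincombB -/(zcomb z) zz subrr.
have /boolp.choice[g hg] x : exists z : n.-tuple int, is_flow x -> zcomb z = realify R x.
  case: (boolP (is_flow x)) => [fx|_]; last by exists [tuple of nseq n 0].
  have : flow_lattice R G (realify R x).
    by rewrite flow_latticeE; exists x => //; exact/flowsT.
  rewrite bspan => -[z _ zx]; exists [tuple z i | i < n] => _.
  by rewrite -zx /zcomb; congr lincomb; apply/funext => i; rewrite tnth_mktuple.
have YE k : Y k = g @` kflows G k.+1.
  apply/seteqP; split=> [z zk|_ [x [fx xk] <-] e]; last first.
    rewrite hg // ffunE -intr_norm -[k%:R]/((k%:Z)%:~R) ler_int.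
    by have := xk e; rewrite -addn1 PoszD ltzD1.
  have : flow_lattice R G (zcomb z) by rewrite bspan; exists (tnth z).
  rewrite flow_latticeE => -[x /flowsT fx xz]; exists x; last first.
    by apply: zcomb_inj; rewrite hg.
  split=> // e; have := zk e; rewrite -xz ffunE -intr_norm -[k%:R]/((k%:Z)%:~R).
  by rewrite ler_int -addn1 PoszD ltzD1.
have g_inj k : set_inj (kflows G k) g.
  move=> x x' /set_mem[fx _] /set_mem[fx' _] gg.
  by apply: (@realify_inj R); rewrite -!hg // gg.
have finY k : finite_set (Y k) by rewrite YE; exact/finite_image/finite_kflows.
have cardY k : (size (fset_set (Y k)))%:R = p.[k.+1%:R].
  by rewrite hp // -(ncard_image (finite_kflows G k.+1) (g_inj k.+1)) -YE.
have memY k z : (z \in fset_set (Y k)) = `[< Y k z >].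
  by rewrite in_fset_set //; apply/idP/asboolP => [/set_mem|/mem_set].
(* Moving each coordinate by at most [1] moves each entry by at most [B]. *)
pose B := Num.bound (\sum_e \sum_i `|tnth b i e|).
have hB e : \sum_i `|tnth b i e| <= B%:R.
  apply: le_trans (ltW (archi_boundP _)); last by apply: sumr_ge0 => *; exact: sumr_ge0.
  by rewrite [X in _ <= X](bigD1 e) //= lerDl sumr_ge0 // => *; exact: sumr_ge0.
have close h (h0 : 0 < h) (y : n.-tuple R) e :
    `|zcomb (cell h y) e - h^-1 * lincomb b (tnth y) e| <= B%:R.
  apply: le_trans (hB e); rewrite -lincombZ.
  have -> : zcomb (cell h y) e - lincomb b (fun i => h^-1 * tnth y i) e
      = lincomb b (fun i => (tnth (cell h y) i)%:~R - h^-1 * tnth y i) e.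
    by rewrite lincombB !ffunE.
  rewrite ffunE; apply: le_trans (ler_norm_sum _ _ _) _; apply: ler_sum => i _.
  rewrite normrM ler_piMl // tnth_map [h^-1 * _]mulrC.
  have /andP[] := floor_itv (tnth y i / h).
  by move: (_ / h) => r; rewrite rmorphD /= => h1 h2; rewrite ler_norml; lra.
have upper (j k : nat) : (0 < k)%N -> (k + B <= j)%N ->
    (lebesgue_vol A <= (p.[j.+1%:R] * k%:R^-1 ^+ n)%:E)%E.
  move=> k0 kj; have h0 : 0 < k%:R^-1 :> R by rewrite invr_gt0 ltr0n.
  rewrite -cardY; apply: vol_le_cells => // y [_ Ay]; rewrite memY; apply/asboolP => e.
  have := close _ h0 y e; rewrite invrK => cl.
  have : `|k%:R * lincomb b (tnth y) e| <= k%:R.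
    by rewrite normrM normr_nat ler_piMr // ler_norml Ay.
  have : k%:R + B%:R <= j%:R :> R by rewrite -natrD ler_nat.
  move: cl; rewrite !ler_norml.
  set a := zcomb _ _; set c := k%:R * _; move: a c (k%:R) (B%:R) (j%:R) => a c k' B' j'.
  by move=> /andP[? ?] ? /andP[? ?]; lra.
have lower (j k : nat) : (0 < k)%N -> (j + B <= k)%N ->
    ((p.[j.+1%:R] * k%:R^-1 ^+ n)%:E <= lebesgue_vol A)%E.
  move=> k0 jk; have kk : 0 < k%:R :> R by rewrite ltr0n.
  have h0 : 0 < k%:R^-1 :> R by rewrite invr_gt0.
  rewrite -cardY; apply: cells_le_vol => // [|y]; first exact: fset_uniq.
  rewrite memY => /asboolP hy; split; first exact: lincomb_flow.
  move=> e; rewrite -ler_norml.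
  rewrite -(ler_pM2l kk) mulr1 -[k%:R in X in X * _]normr_nat -normrM.
  have := close _ h0 y e; rewrite invrK; have := hy e.
  have : j%:R + B%:R <= k%:R :> R by rewrite -natrD ler_nat.
  rewrite !ler_norml.
  set a := zcomb _ _; set c := k%:R * _; move: a c (k%:R) (B%:R) (j%:R) => a c k' B' j'.
  by move=> ? /andP[? ?] /andP[? ?]; lra.
have finV : lebesgue_vol A \is a fin_num.
  rewrite ge0_fin_numE ?lebesgue_vol_ge0 //.
  exact: le_lt_trans (@upper (1 + B)%N 1%N _ _) (ltry _).
rewrite /has_leading_term -(fineK finV); set v := fine (lebesgue_vol A).
have upper' (j k : nat) : (0 < k)%N -> (k + B <= j)%N -> v * k%:R ^+ n <= p.[j.+1%:R].
  move=> k0 /(upper _ _ k0); rewrite -(fineK finV) lee_fin -/v exprVn.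
  by rewrite -ler_pdivlMr ?exprn_gt0 ?ltr0n.
have lower' (j k : nat) : (0 < k)%N -> (j + B <= k)%N -> p.[j.+1%:R] <= v * k%:R ^+ n.
  move=> k0 /(lower _ _ k0); rewrite -(fineK finV) lee_fin -/v exprVn.
  by rewrite ler_pdivrMr ?exprn_gt0 ?ltr0n.
have v0 : 0 < v.
  have : 1 <= v * B.+1%:R ^+ n.
    apply: le_trans (lower' 0%N B.+1 _ _) => //; rewrite hp // ler1n.
    rewrite cardfs_gt0; apply/fset0Pn; exists 0.
    rewrite in_fset_set; last exact: finite_kflows.
    by apply/mem_set; split=> [|e]; [exact: is_flow0|rewrite ffunE].
  apply: contraTT; rewrite -!leNgt -ltNge => v0.
  by apply: le_lt_trans ltr01; rewrite mulr_le0_ge0 // exprn_ge0.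
(* The count of [k]-flows is that of the dilation by [k - 1], whence [B + 1]. *)
have [k k0|k Bk|-> ->//] := @leading_term_squeeze R p n v B.+1 v0.
  case: k k0 => // k _; rewrite lower' ?andbT ?addnS //; last by lia.
  by rewrite hp // ler0n.
by case: k Bk => // k Bk; rewrite upper' //; lia.
Qed.

(** The length of a lattice basis is the degree of the counting polynomial, hence
the same for all bases; regularity provides a basis of length [cyclomatic G]. *)
Theorem kflows_leading_term (p : {poly R}) :
  (forall k : nat, (0 < k)%N -> p.[k%:R] = (ncard (kflows G k))%:R) ->
  has_leading_term p (flow_vol R G) (cyclomatic G).
Proof.
move=> hp; have [b] := @regular_basis R _ _ _ (regular_flows [set: E]).
rewrite -flow_latticeE => hb; rewrite -cycle_rankT.
have [_ sz] := basis_leading_term hb hp.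
rewrite /flow_vol /lattice_vol /a_lattice_basis.
case: xgetP => [[n b'] _ /= hb'|/(_ (existT _ _ b))//].
have := basis_leading_term hb' hp; rewrite /has_leading_term sz => -[-> [->]].
by [].
Qed.

End FlowVolume.
(** * The flow polynomials *)

(** Without isthmi every proper spanning subgraph has smaller cyclomatic number, so
flows with a zero entry do not contribute to the leading term. *)
Lemma nowhere_zero_same_lead (R : realType) (G : graph) (phi phi0 : {poly R}) :
  (forall e : edge G, ~~ isthmus e) ->
  (forall k : nat, (0 < k)%N -> phi.[k%:R] = (ncard (nz_kflows G k))%:R) ->
  (forall k : nat, (0 < k)%N -> phi0.[k%:R] = (ncard (kflows G k))%:R) ->
  size phi0 = (cyclomatic G).+1 ->
  lead_coef phi0 = lead_coef phi /\ size phi0 = size phi.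
Proof.
move=> noi hphi hphi0 sz0.
have rankD1 (S : {set edge G}) : S != [set: edge G]%SET ->
    (cycle_rank S < cyclomatic G)%N.
  move=> SnT; have [e eS] : exists e, e \notin S.
    apply/existsP; apply: contraNT SnT; rewrite negb_exists => /forallP h.
    by apply/eqP/setP => e; rewrite [RHS]inE; have := h e; rewrite negbK.
  rewrite -cycle_rankT (@cycle_rankD1 _ [set: edge G]%SET e) ?inE //.
  have := noi e; rewrite isthmusE negbK => ->; rewrite addn1 ltnS.
  apply: cycle_rank_sub; apply/fintype.subsetP => f fS; rewrite !inE andbT.
  by apply: contraNneq eS => <-.
have /boolp.choice[p hp] (S : {set edge G}) := kflows_on_polynomial R S.
have sp S : (size (p S) <= (cycle_rank S).+1)%N.
  apply: (@size_le_growth _ _ _ (2 ^+ cycle_rank S)) => k k0.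
  have [-> // _ _] := hp S; rewrite normr_nat -exprMn -natrM -natrX ler_nat.
  exact: ncard_kflows_on_le.
have pE : phi = phi0 + \sum_(S : {set edge G} | S != [set: edge G]%SET)
    (-1) ^+ #|~: S| *: p S.
  apply: polyP_nat => k k0; rewrite hornerD hphi // hphi0 //.
  rewrite nz_kflows_inclusion_exclusion (bigD1 [set: edge G]%SET) //=.
  rewrite finset.setCT cards0 expr0 mul1r kflows_onT horner_sum; congr (_ + _).
  by apply: eq_bigr => S _; rewrite hornerZ; have [-> //] := hp S.
have small : (size (\sum_(S : {set edge G} | S != [set: edge G]%SET)
    (-1) ^+ #|~: S| *: p S)%R < size phi0)%N.
  rewrite sz0 ltnS; apply: (leq_trans (size_sum _ _ _)).
  apply/bigmax_leqP => S SnT; rewrite size_scale ?signr_eq0 //.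
  exact: leq_trans (sp S) (rankD1 S SnT).
by rewrite pE size_polyDl // lead_coefDl.
Qed.

Theorem theorem3p1 (R : realType) (G : graph) :
  exists phi phi0 : {poly R},
    [/\ [/\ forall k : nat, (0 < k)%N ->
              phi.[k%:R] = (ncard (nz_kflows G k))%:R,
            (forall e : edge G, ~~ isthmus e) ->
              has_leading_term phi (flow_vol R G) (cyclomatic G)
          & (exists e : edge G, isthmus e) -> phi = 0],
        forall k : nat,
          (-1) ^+ cyclomatic G * phi.[- k%:R] =
          \sum_(x \in kflows G k.+1) ((num_compatible x)%:R : R),
        (-1) ^+ cyclomatic G * phi.[0] = (num_totally_cyclic G)%:R :> R /\
        (num_totally_cyclic G)%:R =
          (-1) ^+ cyclomatic G * (modular_flow_poly R G).[-1] :> R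
      & [/\ forall k : nat, (0 < k)%N ->
              phi0.[k%:R] = (ncard (kflows G k))%:R,
            forall t : R, phi0.[t] = (-1) ^+ cyclomatic G * phi0.[1 - t],
            has_leading_term phi0 (flow_vol R G) (cyclomatic G),
            (forall e : edge G, ~~ isthmus e) ->
              lead_coef phi0 = lead_coef phi /\ size phi0 = size phi
          & phi0`_0 = (-1) ^+ cyclomatic G]].
Proof.
have [phi [hphi hrec hzero]] := nowhere_zero_polynomial G R.
have [phi0 [hphi0 hrec0 hconst0]] := kflows_on_polynomial R [set: edge G]%SET.
rewrite cycle_rankT in hrec0 hconst0.
have {}hphi0 k : (0 < k)%N -> phi0.[k%:R] = (ncard (kflows G k))%:R.
  by move=> /hphi0->; rewrite kflows_onT.
have lead0 := kflows_leading_term hphi0.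
have same noi := nowhere_zero_same_lead noi hphi hphi0 lead0.2.
have constE : (-1) ^+ cyclomatic G * phi.[0] = (num_totally_cyclic G)%:R.
  have := hrec 0%N; rewrite oppr0 => ->; rewrite (_ : kflows G 1 = [set 0]).
    by rewrite fsbig_set1 num_compatible0.
  apply/seteqP; split=> [x [_ h]|_ ->].
    by apply/ffunP => e; rewrite ffunE; have := h e; move: (x e) => z; lia.
  by split=> [|e]; [exact: is_flow0|rewrite ffunE].
exists phi, phi0; split.
- split=> // [noi|[e ise]].
    by rewrite /has_leading_term; have [<- <-] := same noi.
  by apply: hzero => t; exact: isthmus_not_totally_cyclic ise.
- exact: hrec.
- by split=> //; rewrite -constE (constant_term_modular hphi).
- by split=> //; rewrite -horner_coef0.
Qed.
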